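(* Let $G$ be a partial cube of VC-dimension at most $2$ that is an isometric subgraph of the hypercube $Q_m$. Then after at most $\binom{m}{\le 2}=\binom m0+\binom m1+\binom m2$ successive 1-extension steps, $G$ can be canonically completed to a graph $G\urcorner$ (the canonical 1-completion of $G$) that is a two-dimensional COM, and $G$ is an isometric subgraph of $G\urcorner$.
   Context: All graphs are finite, connected and simple. $Q_m$ has as vertices the subsets of $\{1,\dots,m\}$, adjacent iff their symmetric difference has size $1$. An induced subgraph $H$ of $G$ is isometric if distances in $H$ equal those in $G$. A partial cube is a graph isometrically embeddable in a hypercube; it is identified with its image, hence with a set family. Its VC-dimension is the maximum size of a set $X$ with $\{X\cap S:S\in V(G)\}=2^X$; two-dimensional means VC-dimension at most $2$. A subgraph is convex if it contains all shortest paths of $G$ between its vertices. $SK_n$ is obtained from $K_n$ by subdividing each edge once; its original vertices are those of $K_n$. A full subdivision of $G$ is an isometric subgraph isomorphic to some $SK_n$. 1-extension: given a partial cube $G$ of VC-dimension at most $2$ isometrically embedded in $Q_m$ and an inclusion-maximal convex full subdivision $H=SK_n$, $n\ge4$, of $G$, add to $G$ the unique vertex of $Q_m$ adjacent to all original vertices of $H$; the 1-extension is the subgraph of $Q_m$ induced by the enlarged vertex set. The canonical 1-completion $G\urcorner$ is obtained by performing 1-extensions successively (on $G$ and on the intermediate graphs) until no convex full subdivision $SK_n$ with $n\ge4$ is left. COM: a complex of oriented matroids is a pair $(U,\mathcal L)$, $U$ finite, $\varnothing\ne\mathcal L\subseteq\{-1,0,+1\}^U$, such that, with $(X\circ Y)_e=X_e$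 if $X_e\neq0$ and $(X\circ Y)_e=Y_e$ otherwise: $X\circ(-Y)\in\mathcal L$ for all $X,Y\in\mathcal L$; and for all $X,Y\in\mathcal L$ and $e$ with $X_eY_e=-1$ there is $Z\in\mathcal L$ with $Z_e=0$ and $Z_f=(X\circ Y)_f$ for all $f$ with $X_fY_f\neq-1$. It is assumed simple: $\{X_e:X\in\mathcal L\}=\{-1,0,+1\}$ for each $e$, and for all $e\neq f$ there are $X,Y\in\mathcal L$ with $\{X_eX_f,Y_eY_f\}=\{+1,-1\}$. Its topes are the maximal elements of $\mathcal L$ for the product order with $0\le-1$, $0\le+1$; they are $\pm1$-vectors, and the tope graph is the subgraph of the hypercube $\{\pm1\}^U$ induced by them. A partial cube ''is a COM'' if it is isomorphic to the tope graph of a COM. *)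

(* Defs.v *)
From mathcomp Require Import all_boot all_order all_algebra.

Set Implicit Arguments.
Unset Strict Implicit.
Unset Printing Implicit Defensive.

Import GRing.Theory.

(* A finite simple graph is given by an ambient symmetric irreflexive relation
   [e : rel T] and a vertex set [S : {set T}]; it is the subgraph of [e]
   induced by [S]. *)
Section InducedSubgraphs.

Variables (T : finType) (e : rel T).
Implicit Types (S H : {set T}) (x y : T) (p : seq T).

(* [x :: p] is a walk from [x] to [y] inside [S]; its length is [size p]. *)
Definition walk S x y p : Prop :=
  [/\ path e x p, {subset x :: p <= S} & last x p = y].

Definition shortest_path S x y p : Prop :=
  walk S x y p /\ forall q, walk S x y q -> size p <= size q.

Definition is_dist S x y (d : nat) : Prop :=
  exists2 p, shortest_path S x y p & size p = d.

(* If [y] is not reachable from [x], then [is_dist S x y d] holds for no [d],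
   so the equivalence below also covers infinite distances. *)
Definition isometric H S : Prop :=
  H \subset S /\
  {in H &, forall x y, forall d, is_dist H x y d <-> is_dist S x y d}.

Definition convex H S : Prop :=
  H \subset S /\
  {in H &, forall x y, forall p, shortest_path S x y p -> {subset p <= H}}.

End InducedSubgraphs.

Definition graph_iso (T1 T2 : finType) (e1 : rel T1) (S1 : {set T1})
    (e2 : rel T2) (S2 : {set T2}) (f : T1 -> T2) : Prop :=
  [/\ {in S1 &, injective f}, f @: S1 = S2
    & {in S1 &, forall x y, e2 (f x) (f y) = e1 x y}].

(* Adjacency in the hypercube Q_m, whose vertices are the subsets of ['I_m]. *)
Definition cube_adj (m : nat) : rel {set 'I_m} :=
  fun A B => #|(A :\: B) :|: (B :\: A)| == 1.

Definition shatters (m : nat) (V : {set {set 'I_m}}) (X : {set 'I_m}) : bool :=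
  [set X :&: A | A in V] == powerset X.

Definition vc_dim (m : nat) (V : {set {set 'I_m}}) : nat :=
  \max_(X : {set 'I_m} | shatters V X) #|X|.

Definition partial_cube_in (m : nat) (V : {set {set 'I_m}}) : Prop :=
  V != set0 /\ isometric (@cube_adj m) V [set: {set 'I_m}].

Definition two_dimensional (m : nat) (V : {set {set 'I_m}}) : Prop :=
  partial_cube_in V /\ vc_dim V <= 2.

(* Vertices of SK_n: [inl i] is an original vertex, [inr A] is the vertex
   subdividing the edge [A] of K_n. *)
Definition SK_vertex (n : nat) : finType :=
  ('I_n + {A : {set 'I_n} | #|A| == 2})%type.

Definition SK_adj (n : nat) : rel (SK_vertex n) := fun u v =>
  match u, v with
  | inl i, inr A | inr A, inl i => i \in val A
  | _, _ => false
  end.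

(* [H] is a convex full subdivision SK_n of [V]; the isomorphism [f] records
   which vertices of [H] are the original ones. *)
Definition convex_full_subdivision (m : nat) (V : {set {set 'I_m}}) (n : nat)
    (H : {set {set 'I_m}}) (f : SK_vertex n -> {set 'I_m}) : Prop :=
  [/\ convex (@cube_adj m) H V, isometric (@cube_adj m) H V
    & graph_iso (@SK_adj n) setT (@cube_adj m) H f].

Definition maximal_convex_full_subdivision (m : nat) (V : {set {set 'I_m}})
    (n : nat) (H : {set {set 'I_m}}) (f : SK_vertex n -> {set 'I_m}) : Prop :=
  convex_full_subdivision V H f /\
  forall (n' : nat) (H' : {set {set 'I_m}}) (f' : SK_vertex n' -> {set 'I_m}),
    convex_full_subdivision V H' f' -> H \subset H' -> H' = H.

Definition one_extension (m : nat) (V V' : {set {set 'I_m}}) : Prop :=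
  two_dimensional V /\
  exists (n : nat) (H : {set {set 'I_m}}) (f : SK_vertex n -> {set 'I_m})
         (v : {set 'I_m}),
    [/\ 4 <= n, maximal_convex_full_subdivision V H f,
        unique (fun w => forall i : 'I_n, cube_adj w (f (inl i))) v
      & V' = v |: V].

(* [W] is obtained from [V] by [k] successive 1-extensions. *)
Fixpoint one_extensions (m k : nat) (V W : {set {set 'I_m}}) : Prop :=
  if k is k'.+1 then
    exists2 V', one_extension V V' & one_extensions k' V' W
  else V = W.

(* [W] is obtained from [V] by [k] successive 1-extensions, after which no
   convex full subdivision SK_n with [4 <= n] is left. *)
Definition one_completion (m k : nat) (V W : {set {set 'I_m}}) : Prop :=
  one_extensions k V W /\
  forall (n : nat) (H : {set {set 'I_m}}) (f : SK_vertex n -> {set 'I_m}),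
    4 <= n -> ~ convex_full_subdivision W H f.

(* [W] is the result of the 1-completion of [V], whatever the choices made,
   and at most [b] steps are used: every sequence of 1-extensions starting from
   [V] can be continued to a completed one, and all completed ones end in [W]
   after at most [b] steps. *)
Definition canonical_completion (m b : nat) (V W : {set {set 'I_m}}) : Prop :=
  (forall (k : nat) (V' : {set {set 'I_m}}), one_extensions k V V' ->
     exists (l : nat) (W' : {set {set 'I_m}}), one_completion l V' W') /\
  (forall (k : nat) (W' : {set {set 'I_m}}), one_completion k V W' ->
     W' = W /\ k <= b).

(* Sign vectors are finite functions into ['F_3] = {0, 1, -1}; opposite and
   product of ['F_3] are those of signs. *)
Section COM.

Local Open Scope ring_scope.

Variable U : finType.
Implicit Types (X Y Z : {ffun U -> 'F_3}) (L : {set {ffun U -> 'F_3}}).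

Definition composition X Y : {ffun U -> 'F_3} :=
  [ffun e => if X e != 0 then X e else Y e].

Definition com_axioms L : Prop :=
  [/\ L != set0,
      forall X Y, X \in L -> Y \in L -> composition X (- Y) \in L
    & forall X Y (e : U), X \in L -> Y \in L -> X e * Y e = -1 ->
        exists Z, [/\ Z \in L, Z e = 0
          & forall f : U, X f * Y f != -1 -> Z f = composition X Y f]].

Definition simple_system L : Prop :=
  (forall e : U, [set (X : {ffun U -> 'F_3}) e | X in L] = [set -1; 0; 1]) /\
  (forall e f : U, e != f -> exists X Y,
     [/\ X \in L, Y \in L & [set X e * X f; Y e * Y f] = [set 1; -1]]).

Definition sign_vector_le X Y : bool :=
  [forall e, (X e == 0) || (X e == Y e)].

Definition topes L : {set {ffun U -> 'F_3}} :=
  [set X in L | [forall Y in L, sign_vector_le X Y ==> (Y == X)]].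

Definition tope_adj : rel {ffun U -> 'F_3} :=
  fun X Y => #|[set e | X e != Y e]| == 1%N.

End COM.

Definition is_COM (m : nat) (W : {set {set 'I_m}}) : Prop :=
  exists (U : finType) (L : {set {ffun U -> 'F_3}}),
    [/\ com_axioms L, simple_system L
      & exists f : {set 'I_m} -> {ffun U -> 'F_3},
          graph_iso (@cube_adj m) W (@tope_adj U) (topes L) f].

(* Main.v *)
Require Import Defs.
From mathcomp Require Import all_boot all_order all_algebra zify.

(**
Adding to a two-dimensional isometric family [V] the apex of a convex [SK_n]
amounts to adding a vertex [v] outside [V] with at least four neighbours in
[V]: if [v] is outside [V], the vertices at distance two between two of its
neighbours are in [V] by isometry, and four neighbours leave no room for
anything else without shattering a triple. This condition on [v] is monotone
in [V], so the completion is a closure and does not depend on the choices; the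
number of steps is bounded by the Sauer-Shelah inequality.

The covectors of the completion are the sign vectors [X] such that [X o (-T)]
is a tope for every tope [T]; only strong elimination is not formal. It is
trivial when [X] and [Y] have no common zero, vacuous when they have two or more
(three coordinates would be shattered), and when [g] is the only common zero
it reduces to two edges in direction [g] with no third such edge between them:
these span an even cycle on a set [D] of coordinates, and one shows that
no vertex of the family projects on [D] outside this cycle. For [#|D| = 3] an
outside projection yields a missing vertex with four neighbours; for
[#|D| >= 4] it contradicts the bound on the VC-dimension.
*)

Set Implicit Arguments.
Unset Strict Implicit.
Unset Printing Implicit Defensive.

(** * Isometric families in the cube *)

Section Cube.

Variable m : nat.
Implicit Types (A B C D x y v : {set 'I_m}) (V W : {set {set 'I_m}}).
Implicit Types (i j k : 'I_m).

(** The pivot is [nbr_toward], which asks for three neighbours of a missing vertex [v] rather than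
    four, and serves twice. For a vertex with four neighbours it shows that adding it keeps the
    family isometric. For [#|D| = 3] the cycle is a hexagon in a 3-cube. If [T] projects to a corner
    [v] outside it, the hexagon gives [v] three neighbours, and [nbr_toward] finds one more in the
    direction of [T], so [v] could still be added. On a longer cycle no single vertex can be blamed.
    There a bad projection is already bad on four well-chosen coordinates, and the question becomes
    one on subsets of the 4-cube, few enough to be enumerated. Projections matter because the sign
    vector vanishing on [D] is a covector only if the cycle contains, for every tope [T], a vertex
    opposite to [T] on all of [D]. A [T] that projects into the cycle has one, since the cycle is
    antipodal. *)

Definition sep A B : {set 'I_m} := [set i | (i \in A) (+) (i \in B)].
Definition flip A i : {set 'I_m} := [set j | (j \in A) (+) (j == i)].

Lemma sepC A B : sep A B = sep B A.
Proof. by apply/setP=> i; rewrite !inE addbC. Qed.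

Lemma sepxx A : sep A A = set0.
Proof. by apply/setP=> i; rewrite !inE addbb. Qed.

Lemma sep_eq0 A B : (sep A B == set0) = (A == B).
Proof.
apply/eqP/eqP=> [/setP sAB|->]; last exact: sepxx.
by apply/setP=> i; have := sAB i; rewrite !inE; do 2!case: (_ \in _).
Qed.

Lemma sepK A B : sep A (sep A B) = B.
Proof. by apply/setP=> i; rewrite !inE addKb. Qed.

Lemma sep_sep C A B : sep (sep C A) (sep C B) = sep A B.
Proof. by apply/setP=> i; rewrite !inE; do 3!case: (_ \in _). Qed.

Lemma card_sep A B : #|sep A B| + 2 * #|A :&: B| = #|A| + #|B|.
Proof.
rewrite -(cardsID B A) -(cardsID A B) [B :&: A]setIC.
have -> : sep A B = (A :\: B) :|: (B :\: A).
  by apply/setP=> i; rewrite !inE; do 2!case: (_ \in _).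
rewrite cardsU; have -> : (A :\: B) :&: (B :\: A) = set0.
  by apply/setP=> i; rewrite !inE; do 2!case: (_ \in _).
rewrite cards0; lia.
Qed.

Lemma sep_flip A i : sep A (flip A i) = [set i].
Proof. by apply/setP=> j; rewrite !inE; case: (_ \in _); case: (_ == _). Qed.

Lemma flipK A i : flip (flip A i) i = A.
Proof. by apply/setP=> j; rewrite !inE -addbA addbb addbF. Qed.

Lemma flipC A i j : flip (flip A i) j = flip (flip A j) i.
Proof. by apply/setP=> k; rewrite !inE -!addbA [(_ == i) (+) _]addbC. Qed.

Lemma flip_inj A : injective (flip A).
Proof.
move=> i j /(congr1 (sep A)); rewrite !sep_flip => /setP/(_ i).
by rewrite !inE eqxx => /esym/eqP.
Qed.

Lemma sep_flipl A B i : i \in sep A B -> sep (flip A i) B = sep A B :\ i.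
Proof.
move=> iAB; apply/setP=> j; rewrite !inE; case: eqP => [->|_] /=.
  by move: iAB; rewrite !inE; do 2!case: (_ \in _).
by rewrite addbF.
Qed.

Lemma cube_adjE A B : cube_adj A B = (#|sep A B| == 1).
Proof.
rewrite /cube_adj; congr (#|pred_of_set _| == 1).
by apply/setP=> i; rewrite !inE; do 2!case: (_ \in _).
Qed.

Lemma cube_adjP A B : reflect (exists i, B = flip A i) (cube_adj A B).
Proof.
rewrite cube_adjE; apply: (iffP cards1P) => -[i Ei]; exists i.
  by rewrite -[B](sepK A) Ei; apply/setP=> j; rewrite !inE.
by rewrite Ei sep_flip.
Qed.

Lemma cube_adjC A B : cube_adj A B = cube_adj B A.
Proof. by rewrite !cube_adjE sepC. Qed.

Lemma cube_adj_flip A i : cube_adj A (flip A i).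
Proof. by apply/cube_adjP; exists i. Qed.

Lemma sep_between A B C :
  #|sep A C| + #|sep C B| <= #|sep A B| -> sep A C \subset sep A B.
Proof.
have := card_sep (sep A C) (sep C B).
rewrite {1}[sep A C]sepC sep_sep => E leS.
have /eqP/cards0_eq/setP I0 : #|sep A C :&: sep C B| == 0 by lia.
apply/subsetP=> i; move: (I0 i); rewrite !inE.
by do 3!case: (_ \in _).
Qed.

Lemma between_eq A B C i :
  sep A C \subset sep A B -> (i \in A) = (i \in B) -> (i \in C) = (i \in A).
Proof.
move=> /subsetP/(_ i)/implyP; rewrite !inE.
by do 3!case: (_ \in _).
Qed.

(** Local form of isometry in the cube. It mentions no paths, so it can be checked directly when a
    vertex is added. *)
Definition steps V :=
  {in V &, forall A B, A != B -> exists2 i, i \in sep A B & flip A i \in V}.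

Lemma steps_setT : steps setT.
Proof.
move=> A B _ _; rewrite -sep_eq0 => /set0Pn[i iAB].
by exists i; rewrite ?in_setT.
Qed.

Lemma path_sep A p : path (@cube_adj m) A p -> #|sep A (last A p)| <= size p.
Proof.
elim: p A => [|B p IH] A /=; first by rewrite sepxx cards0.
case/andP=> /cube_adjP[i ->] /IH le_p.
set C := last _ p in le_p *.
have /subset_leq_card : sep A C \subset i |: sep (flip A i) C.
  by apply/subsetP=> j; rewrite !inE; case: eqP; rewrite ?orbT ?addbF.
move/leq_trans; apply; rewrite cardsU1 -add1n; apply: leq_add le_p.
by case: (_ \notin _).
Qed.

Lemma steps_walk V A B : steps V -> A \in V -> B \in V ->
  exists2 p, walk (@cube_adj m) V A B p & size p = #|sep A B|.
Proof.
move=> sV; move En : #|sep A B| => n; elim: n A En => [|n IH] A En VA VB.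
  have /eqP AB : A == B by rewrite -sep_eq0 -cards_eq0 En.
  by exists [::] => //; split=> // C; rewrite inE => /eqP->.
have neqAB : A != B by rewrite -sep_eq0 -cards_eq0 En.
have [i iAB Vi] := sV A B VA VB neqAB.
have [|//|//|p [pth sub lst] sz] := IH (flip A i).
  by rewrite sep_flipl // [RHS]pred_Sn -En (cardsD1 i (sep A B)) iAB.
exists (flip A i :: p); last by rewrite /= sz.
split=> //=; first by rewrite cube_adj_flip.
by move=> C; rewrite inE => /orP[/eqP->|/sub].
Qed.

Lemma steps_shortest V A B p : steps V -> A \in V -> B \in V ->
  shortest_path (@cube_adj m) V A B p <->
  walk (@cube_adj m) V A B p /\ size p = #|sep A B|.
Proof.
move=> sV VA VB.
have lb q : walk (@cube_adj m) V A B q -> #|sep A B| <= size q.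
  by case=> pth _ <-; apply: path_sep.
split=> [[wp min]|[wp sz]].
  split=> //; have [q wq Eq] := steps_walk sV VA VB.
  by apply/eqP; rewrite eqn_leq lb // -Eq min.
by split=> // q /lb; rewrite sz.
Qed.

Lemma steps_dist V A B d : steps V -> A \in V -> B \in V ->
  is_dist (@cube_adj m) V A B d <-> d = #|sep A B|.
Proof.
move=> sV VA VB; split=> [[p sp <-]|->].
  by have [] := (steps_shortest p sV VA VB).1 sp.
have [p wp Ep] := steps_walk sV VA VB.
by exists p => //; apply/(steps_shortest p sV VA VB).
Qed.

Lemma shortest_between V A B C p : steps V -> A \in V -> B \in V ->
  shortest_path (@cube_adj m) V A B p -> C \in p -> sep A C \subset sep A B.
Proof.
move=> sV VA VB /(steps_shortest p sV VA VB)[[pth _ lst] sz] Cp.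
apply: sep_between; rewrite -sz.
case/path.splitP: Cp pth lst => p1 p2; rewrite cat_path last_cat last_rcons.
case/andP=> /path_sep; rewrite last_rcons => le1 /path_sep le2 lst.
by rewrite lst in le2; rewrite size_cat leq_add.
Qed.

Lemma steps_isometric V W : V \subset W -> steps V -> steps W ->
  isometric (@cube_adj m) V W.
Proof.
move=> sVW sV sW; split=> // A B VA VB d; rewrite !steps_dist //.
all: exact: (subsetP sVW).
Qed.

Lemma isometric_steps V : isometric (@cube_adj m) V setT -> steps V.
Proof.
case=> _ iV A B VA VB neqAB.
have /(iV A B VA VB)[p [[pth sub lst] min] sz] :
  is_dist (@cube_adj m) setT A B #|sep A B|.
  by apply/(steps_dist _ steps_setT); rewrite ?in_setT.
case: p pth sub lst min sz => [|A' p] /=.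
  by move=> _ _ eqAB; rewrite eqAB eqxx in neqAB.
case/andP=> /cube_adjP[i ->] /path_sep le_p sub lst _ sz.
exists i; last by apply: sub; rewrite !inE eqxx orbT.
rewrite lst in le_p; apply: contraLR (le_p) => niAB.
have -> : sep (flip A i) B = i |: sep A B.
  apply/setP=> j; rewrite !inE; case: eqP => [->|_]; last by rewrite addbF.
  by move: niAB; rewrite inE; do 2!case: (_ \in _).
by rewrite cardsU1 niAB -sz -ltnNge; lia.
Qed.

(** [C] is the last vertex before the crossing of [i] on a geodesic from [A] to [B]. *)
Lemma steps_edge V A B i : steps V -> A \in V -> B \in V -> i \in sep A B ->
  exists C, [/\ C \in V, flip C i \in V, sep A C \subset sep A B
              & i \notin sep A C].
Proof.
move=> sV; move En : #|sep A B| => n; elim: n A En => [|n IH] A En VA VB iAB.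
  by rewrite (cards0_eq En) inE in iAB.
have neqAB : A != B by rewrite -sep_eq0 -cards_eq0 En.
have [a aAB Va] := sV A B VA VB neqAB.
have [eia|neia] := eqVneq i a.
  by exists A; split; rewrite ?eia ?sepxx ?sub0set ?inE.
have sE := sep_flipl aAB.
have [|//|//||C [VC VCi sAC niAC]] := IH (flip A a).
- by rewrite sE [RHS]pred_Sn -En (cardsD1 a (sep A B)) aAB.
- by rewrite sE in_setD1 neia.
exists C; split=> //; last first.
  by move: niAC; rewrite !inE (negPf neia) addbF.
apply/subsetP=> j jAC; have [->//|nja] := eqVneq j a.
have: j \in sep (flip A a) C by move: jAC; rewrite !inE (negPf nja) addbF.
by move/(subsetP sAC); rewrite sE => /setD1P[].
Qed.

(** Take the edge of a geodesic that crosses [i]: its first end serves if [j] has been crossed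
    already, its second end otherwise. *)
Lemma steps_split V A B i j : steps V -> A \in V -> B \in V -> i != j ->
  i \in sep A B -> j \in sep A B ->
  exists C, [/\ C \in V, sep A C \subset sep A B
              & (i \in sep A C) != (j \in sep A C)].
Proof.
move=> sV VA VB nij iAB jAB.
have [C [VC VCi sAC niAC]] := steps_edge sV VA VB iAB.
have [jAC|njAC] := boolP (j \in sep A C).
  by exists C; rewrite jAC (negPf niAC).
exists (flip C i); split=> //.
  apply/subsetP=> k; rewrite !inE; case: eqP => [->|_]; last first.
    by rewrite addbF => kAC; have := subsetP sAC k; rewrite !inE; apply.
  by move: iAB; rewrite inE.
move: niAC njAC; rewrite !inE eqxx [j == i]eq_sym (negPf nij).
by do 4!case: (_ \in _).
Qed.

(** Traces are read relative to a base point [x], on which shattering does not depend. It can then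
    be the missing vertex or an end of an interval. *)
Definition shattered3 V x i j k := forall a b c : bool,
  exists2 A, A \in V & [/\ (i \in sep x A) = a, (j \in sep x A) = b
                         & (k \in sep x A) = c].

Definition vc2 V := forall x i j k, i != j -> i != k -> j != k ->
  ~ shattered3 V x i j k.

Lemma shattersP V (X : {set 'I_m}) :
  reflect (forall Y : {set 'I_m}, Y \subset X -> exists2 A, A \in V & X :&: A = Y)
    (shatters V X).
Proof.
apply: (iffP eqP) => [E Y sYX|H].
  have : Y \in powerset X by rewrite powersetE.
  by rewrite -E => /imsetP[A VA ->]; exists A.
apply/setP=> Y; rewrite powersetE; apply/imsetP/idP => [[A VA ->]|/H[A VA <-]].
  exact: subsetIl.
by exists A.
Qed.

Lemma shatters_sub V (X Y : {set 'I_m}) :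
  Y \subset X -> shatters V X -> shatters V Y.
Proof.
move=> sYX /shattersP sX; apply/shattersP=> Z sZY.
have [A VA E] := sX Z (subset_trans sZY sYX).
by exists A; rewrite // -(setIidPl sYX) -setIA E; apply/setIidPr.
Qed.

Lemma vc_dim_vc2 V : vc_dim V <= 2 <-> vc2 V.
Proof.
split=> [/bigmax_leqP le2 x i j k nij nik njk sh|v2].
  have := le2 [set i; j; k].
  rewrite setUC cardsU1 cards2 nij !inE negb_or ![k == _]eq_sym nik njk setUC => le2'.
  suff /le2' : shatters V [set i; j; k] by [].
  apply/shattersP=> Y sY.
  have [A VA [Ai Aj Ak]] := sh (i \in sep x Y) (j \in sep x Y) (k \in sep x Y).
  have E l : (l \in sep x A) = (l \in sep x Y) -> (l \in A) = (l \in Y).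
    by rewrite !inE; do 3!case: (_ \in _).
  exists A => //; apply/setP=> l; rewrite inE.
  have [|lS] /= := boolP (l \in [set i; j; k]).
    by rewrite !inE => /orP[/orP[]|]/eqP->; apply: E.
  by apply/esym/negbTE; apply: contra lS; apply: (subsetP sY).
apply/bigmax_leqP=> X sX; rewrite leqNgt; apply/negP.
move/card_gt2P=> [i [j [k [[Xi Xj Xk] [nij njk nik]]]]].
rewrite eq_sym in nik.
apply: (v2 set0 i j k) => // a b c.
have /shattersP/(_ [set l in [set i; j; k] |
   [|| (l == i) && a, (l == j) && b | (l == k) && c]]) : shatters V [set i; j; k].
  apply: shatters_sub sX; apply/subsetP=> l; rewrite !inE.
  by case/orP=> [/orP[]|] /eqP->.
case=> [|A VA /setP E]; first by apply/subsetP=> l; rewrite inE => /andP[].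
exists A => //; have := E i; have := E j; have := E k.
rewrite !inE !eqxx [j == i]eq_sym ![k == _]eq_sym (negPf nij) (negPf nik) (negPf njk).
by rewrite ?orbT /= ?orbF => -> -> ->.
Qed.

Lemma two_dimensionalP V : two_dimensional V <-> [/\ V != set0, steps V & vc2 V].
Proof.
rewrite /two_dimensional /partial_cube_in vc_dim_vc2.
split=> [[[V0 /isometric_steps sV] v2]|[V0 sV v2]] //.
by split=> //; split=> //; apply: steps_isometric; rewrite ?subsetT //; apply: steps_setT.
Qed.

End Cube.

(** * Vertices that can be added *)

Section Extension.

Variable m : nat.
Implicit Types (A B C D T S x v : {set 'I_m}) (V W : {set {set 'I_m}}).
Implicit Types (i j k : 'I_m).

Definition nbr V v : {set 'I_m} := [set i | flip v i \in V].

Lemma sep_flipr A B i : sep A (flip B i) = [set j | (j \in sep A B) (+) (j == i)].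
Proof. by apply/setP=> j; rewrite !inE addbA. Qed.

(** Only two vertices can be the middle of a geodesic from [flip v i] to [flip v j], and one of them
    is [v]. *)
Lemma nbr_pair V v i j : steps V -> v \notin V -> i \in nbr V v ->
  j \in nbr V v -> i != j -> flip (flip v i) j \in V.
Proof.
move=> sV Vv; rewrite !inE => Vi Vj nij.
have [|a] := sV _ _ Vi Vj; first by apply: contra nij => /eqP/flip_inj->.
rewrite !inE => aij; have [->|nai] := eqVneq a i.
  by rewrite flipK (negPf Vv).
suff -> : a = j by [].
apply/eqP; move: aij; rewrite (negPf nai) addbF.
by case: (_ \in _); case: (_ == _).
Qed.

(* Take [T] closest to [v]; all [T + i], [T + j], [T + k] are then in [V]. If
   [T] and [v] differ at [r != s], no member of [V] differs from [v] at [r] and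
   two of [i, j, k]. The geodesic from [T + i] to [v + i] crosses [r] and [s] in
   some order; two of [i, j, k] see the same order, and this makes a geodesic
   between two members of [V] impossible. *)
Lemma nbr_toward V v T i j k : steps V -> vc2 V -> v \notin V ->
    i != j -> i != k -> j != k ->
    i \in nbr V v -> j \in nbr V v -> k \in nbr V v ->
    T \in V -> i \notin sep v T -> j \notin sep v T -> k \notin sep v T ->
  exists2 r, r \in sep v T & r \in nbr V v.
Proof.
move=> sV v2 Vv nij nik njk Ni Nj Nk VT niT njT nkT.
pose P T' := (T' \in V) && (sep v T' \subset sep v T).
have PT : P T by rewrite /P VT subxx.
case: (arg_minnP (fun T' => #|sep v T'|) PT) => T0 /andP[VT0 sT0] min0.
move eR : (sep v T0) sT0 min0 => R sT0 min0.
have minR S : S \in V -> sep v S \subset R -> R \subset sep v S.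
  move=> VS sSR; suff /eqP-> : sep v S == R by [].
  rewrite eqEcard sSR; apply: min0.
  by rewrite /P VS (subset_trans sSR sT0).
have [R1|] := leqP #|R| 1.
  have /set0Pn[r Rr] : R != set0.
    by rewrite -eR sep_eq0; apply: contraNneq Vv => ->.
  exists r; first exact: (subsetP sT0).
  rewrite inE; suff -> : flip v r = T0 by [].
  rewrite -[T0](sepK v) eR; suff -> : R = [set r].
    by apply/setP=> y; rewrite !inE.
  apply/eqP; rewrite eq_sym eqEcard sub1set Rr cards1; exact: R1.
case/card_gt1P=> r [s [Rr Rs nrs]].
pose D := [set i; j; k].
have DN a : a \in D -> a \in nbr V v.
  by rewrite !in_setU !in_set1 => /orP[/orP[]|]/eqP->.
have DR a : a \in D -> a \notin R.
  move=> Da; suff : a \notin sep v T by apply: contra; apply: (subsetP sT0).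
  by move: Da; rewrite !in_setU !in_set1 => /orP[/orP[]|]/eqP->.
have memT0 a : (a \in T0) = (a \in v) (+) (a \in R).
  by rewrite -eR !inE addKb.
have T0D a : a \in D -> flip T0 a \in V.
  move=> Da; have Va := DN a Da; rewrite inE in Va.
  have [|x] := sV _ _ VT0 Va.
    apply: contraNneq (DR a Da) => E; have := memT0 r.
    rewrite Rr E !inE; case: eqP => [<-|_]; last by case: (_ \in _).
    by [].
  have [->//|nxa] := eqVneq x a.
  rewrite !inE (negPf nxa) addbF => xR VTx.
  have {}xR : x \in R by rewrite -eR inE addbC.
  have sub : sep v (flip T0 x) \subset R.
    apply/subsetP=> y; rewrite sep_flipr inE eR; case: eqP => [->|_].
      by rewrite xR.
    by rewrite addbF.
  by have := subsetP (minR _ VTx sub) x; rewrite sep_flipr inE eR eqxx xR => /(_ isT).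
(* Otherwise [a, b, c] is shattered: [S], [T0] and the flips of [T0] give the traces containing [c],
   the vertices around [v] the others. As [v] is missing, the third neighbour [flip v d] stands in
   for the empty trace. *)
have F2 a b d S c : [/\ a \in D, b \in D & d \in D] ->
    [/\ a != b, a != d & b != d] -> S \in V -> c \in R ->
    a \in sep v S -> b \in sep v S -> c \notin sep v S.
  move=> [Da Db Dd] [nab nad nbd] VS Rc Sa Sb; apply/negP=> Sc.
  have nac : a != c by apply: contraNneq (DR a Da) => ->.
  have nbc : b != c by apply: contraNneq (DR b Db) => ->.
  have ndc : d != c by apply: contraNneq (DR d Dd) => ->.
  have [Va Vb Vd] : [/\ flip v a \in V, flip v b \in V & flip v d \in V].
    by have [] := (DN _ Da, DN _ Db, DN _ Dd); rewrite !inE => -[].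
  have nRa := negPf (DR a Da); have nRb := negPf (DR b Db).
  apply: (v2 v a b c) => // -[] [] [].
  - by exists S; rewrite ?Sa ?Sb ?Sc.
  - exists (flip (flip v a) b); first by apply: nbr_pair; rewrite ?DN.
    by rewrite !sep_flipr sepxx !inE !eqxx ![c == _]eq_sym [b == a]eq_sym
      (negPf nab) (negPf nac) (negPf nbc).
  - exists (flip T0 a); first exact: T0D.
    by rewrite !sep_flipr eR !inE !eqxx nRa nRb Rc
      ![c == _]eq_sym [b == a]eq_sym (negPf nab) (negPf nac).
  - exists (flip v a) => //.
    by rewrite !sep_flipr sepxx !inE !eqxx ![c == _]eq_sym [b == a]eq_sym
      (negPf nab) (negPf nac).
  - exists (flip T0 b); first exact: T0D.
    by rewrite !sep_flipr eR !inE !eqxx nRa nRb Rc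
      ![c == _]eq_sym (negPf nab) (negPf nbc).
  - exists (flip v b) => //.
    by rewrite !sep_flipr sepxx !inE !eqxx ![c == _]eq_sym
      (negPf nab) (negPf nbc).
  - by exists T0; rewrite // eR nRa nRb Rc.
  exists (flip v d) => //.
  by rewrite !sep_flipr sepxx !inE ![c == _]eq_sym
      (negPf nad) (negPf nbd) (negPf ndc).
have F3 a : a \in D -> exists S, [/\ S \in V, sep v S \subset a |: R,
    a \in sep v S & (r \in sep v S) != (s \in sep v S)].
  move=> Da; have Va := DN a Da; rewrite inE in Va.
  have nra : r != a by apply: contraTneq Rr => ->; apply: DR.
  have nsa : s != a by apply: contraTneq Rs => ->; apply: DR.
  have sE : sep (flip T0 a) (flip v a) = R.
    by rewrite -eR; apply/setP=> y; rewrite !inE; do 2!case: (_ \in _); case: (_ == _).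
  have [||C [VC sC rsC]] := steps_split sV (T0D a Da) Va nrs.
  - by rewrite sE.
  - by rewrite sE.
  have eC y : (y \in sep v C) = (y \in sep (flip T0 a) C) (+) (y \in a |: R).
    have := DR a Da; rewrite -eR !inE; case: eqP => [->|_];
    by do !case: (_ \in _).
  have nRC y : y \notin R -> y \notin sep (flip T0 a) C.
    by apply: contra => /(subsetP sC); rewrite sE.
  exists C; split=> //.
  - apply/subsetP=> y; rewrite eC; apply: contraTT => nyR.
    by rewrite (negPf nyR) addbF nRC //; apply: contra nyR => yR; rewrite !inE yR orbT.
  - by rewrite eC setU11 addbT nRC // DR.
  - rewrite !eC !in_setU1 Rr Rs !orbT !addbT.
    by move: rsC; do 2!case: (_ \in _).
have F4 a b d S S' p q : [/\ a \in D, b \in D & d \in D] ->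
    [/\ a != b, a != d & b != d] -> p \in R -> q \in R ->
    S \in V -> sep v S \subset a |: R -> a \in sep v S ->
    S' \in V -> sep v S' \subset b |: R -> b \in sep v S' ->
    p \in sep v S -> p \in sep v S' -> q \notin sep v S -> q \notin sep v S' ->
    False.
  move=> Ds neqs Rp Rq VS sS Sa VS' sS' S'b Sp S'p Sq S'q.
  have [[Da Db Dd] [nab nad nbd]] := (Ds, neqs).
  have nS'a : a \notin sep v S'.
    apply/negP=> /(subsetP sS'); rewrite in_setU1 (negPf nab) /=.
    exact/negP/DR.
  have aSS' : a \in sep S S'.
    by rewrite -(sep_sep v) inE Sa (negPf nS'a).
  (* [C] is about to lose [a]. By [F2] it does not have [b], so after the crossing it differs from
     [v] only within [R], yet not at [q], against [minR]. *)
  have [C [VC VCa sC aC]] := steps_edge sV VS VS' aSS'.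
  have eC y : (y \in sep v S) = (y \in sep v S') -> (y \in sep v C) = (y \in sep v S).
    move=> E; apply: between_eq E; by rewrite !sep_sep.
  have Ca : a \in sep v C.
    by move: aC Sa; rewrite !inE; do 3!case: (_ \in _).
  have Cp : p \in sep v C by rewrite eC ?Sp ?S'p.
  have nCq : q \notin sep v C by rewrite eC (negPf Sq) ?(negPf S'q).
  have [Cb|nCb] := boolP (b \in sep v C).
    by have := F2 a b d C p Ds neqs VC Rp Ca Cb; rewrite Cp.
  have sCR : sep v (flip C a) \subset R.
    apply/subsetP=> y; rewrite sep_flipr inE; have [->|nya] := eqVneq y a.
      by rewrite Ca.
    rewrite addbF => Cy; have [|nSy] := boolP (y \in sep v S).
      by move/(subsetP sS); rewrite in_setU1 (negPf nya).
    have [|nSy'] := boolP (y \in sep v S').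
      move/(subsetP sS'); rewrite in_setU1; case: eqP => // E.
      by rewrite -E Cy in nCb.
    by rewrite eC (negPf nSy) ?(negPf nSy') in Cy.
  have := subsetP (minR _ VCa sCR) q Rq; rewrite sep_flipr inE (negPf nCq).
  by apply/negP; apply: contraTneq Rq => ->; apply: DR.
have [Di Dj Dk] : [/\ i \in D, j \in D & k \in D].
  by rewrite !inE !eqxx !orbT.
have [Si [Vi si ai ri]] := F3 i Di.
have [Sj [Vj sj aj rj]] := F3 j Dj.
have [Sk [Vk sk ak rk]] := F3 k Dk.
have [nji nki nkj] : [/\ j != i, k != i & k != j].
  by rewrite ![_ == i]eq_sym [k == j]eq_sym.
have F5 a b d S S' : [/\ a \in D, b \in D & d \in D] ->
    [/\ a != b, a != d & b != d] ->
    S \in V -> sep v S \subset a |: R -> a \in sep v S ->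
    S' \in V -> sep v S' \subset b |: R -> b \in sep v S' ->
    (r \in sep v S) != (s \in sep v S) -> (r \in sep v S') != (s \in sep v S') ->
    (r \in sep v S) != (r \in sep v S').
  move=> Ds neqs VS sS Sa VS' sS' S'b rs rs'; apply/negP=> /eqP E.
  have := F4 a b d S S' r s Ds neqs Rr Rs VS sS Sa VS' sS' S'b.
  have := F4 a b d S S' s r Ds neqs Rs Rr VS sS Sa VS' sS' S'b.
  move: rs rs' E; case: (r \in sep v S); case: (s \in sep v S) => // _;
  case: (r \in sep v S'); case: (s \in sep v S') => //= _ _ H1 H2.
  - exact: H2.
  - exact: H1.
have Eij : (r \in sep v Si) != (r \in sep v Sj) by apply: (F5 i j k).
have Eik : (r \in sep v Si) != (r \in sep v Sk) by apply: (F5 i k j).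
have Ejk : (r \in sep v Sj) != (r \in sep v Sk) by apply: (F5 j k i).
by move: Eij Eik Ejk; do 3!case: (_ \in _).
Qed.

End Extension.

(** * Vertices with four neighbours, and common neighbours in the cube *)

Section Apex.

Variable m : nat.
Implicit Types (A B C D T S v w : {set 'I_m}) (V W H : {set {set 'I_m}}).
Implicit Types (i j k : 'I_m).

Definition apex V v := (v \notin V) && (4 <= #|nbr V v|).

Lemma card_avoid3 (N : {set 'I_m}) i j k : 4 <= #|N| ->
  exists2 l, l \in N & [/\ l != i, l != j & l != k].
Proof.
move=> N4; have le3 : #|[set i; j; k]| <= 3.
  by rewrite setUC cardsU1 cards2 (leq_add (leq_b1 _)) // ltnS leq_b1.
have /card_gt0P[l] : 0 < #|N :\: [set i; j; k]|.
  rewrite cardsD subn_gt0 (leq_ltn_trans _ N4) //.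
  by rewrite (leq_trans (subset_leq_card (subsetIr _ _))).
rewrite !inE !negb_or => /andP[/andP[/andP[li lj] lk] lN].
by exists l.
Qed.

(** Three such directions would be shattered: [T] gives the full trace, the vertices at distance one
    and two from [v] the middle ones, a fourth neighbour of [v] the empty one. This is what makes
    [SK_family] convex. *)
Lemma apex_card_sep V v T : steps V -> vc2 V -> apex V v -> T \in V ->
  #|sep v T :&: nbr V v| <= 2.
Proof.
move=> sV v2 /andP[Vv N4] VT; rewrite leqNgt; apply/negP.
move/card_gt2P=> [i [j [k [[]]]]].
rewrite !in_setI => /andP[Ti Ni] /andP[Tj Nj] /andP[Tk Nk] [nij njk nki].
have nik : i != k by rewrite eq_sym.
have [l Nl [nli nlj nlk]] := card_avoid3 i j k N4.
have pair a b : a \in nbr V v -> b \in nbr V v -> a != b ->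
    flip (flip v a) b \in V by move=> *; apply: nbr_pair.
have one a : a \in nbr V v -> flip v a \in V by rewrite inE.
have N := (negPf nij, negPf njk, negPf nik).
have S := (eq_sym j i, eq_sym k i, eq_sym k j).
apply: (v2 v i j k) => // -[] [] [].
- by exists T.
- by exists (flip (flip v i) j); rewrite ?pair // !sep_flipr sepxx !inE ?eqxx ?S ?N.
- by exists (flip (flip v i) k); rewrite ?pair // !sep_flipr sepxx !inE ?eqxx ?S ?N.
- by exists (flip v i); rewrite ?one // !sep_flipr sepxx !inE ?eqxx ?S ?N.
- by exists (flip (flip v j) k); rewrite ?pair // !sep_flipr sepxx !inE ?eqxx ?S ?N.
- by exists (flip v j); rewrite ?one // !sep_flipr sepxx !inE ?eqxx ?S ?N.
- by exists (flip v k); rewrite ?one // !sep_flipr sepxx !inE ?eqxx ?S ?N.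
exists (flip v l); rewrite ?one // !sep_flipr sepxx !inE ![_ == l]eq_sym.
by rewrite (negPf nli) (negPf nlj) (negPf nlk).
Qed.

Lemma apex_toward V v T : steps V -> vc2 V -> apex V v -> T \in V ->
  exists2 r, r \in sep v T & flip v r \in V.
Proof.
move=> sV v2 /andP[Vv N4] VT.
have /card_gt2P[i [j [k [[Ni Nj Nk] [nij njk nki]]]]] := ltnW N4.
have nik : i != k by rewrite eq_sym.
have [Ti|nTi] := boolP (i \in sep v T); first by exists i; rewrite inE in Ni.
have [Tj|nTj] := boolP (j \in sep v T); first by exists j; rewrite inE in Nj.
have [Tk|nTk] := boolP (k \in sep v T); first by exists k; rewrite inE in Nk.
have [r rT] := nbr_toward sV v2 Vv nij nik njk Ni Nj Nk VT nTi nTj nTk.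
by rewrite inE; exists r.
Qed.

Lemma apex_steps V v : steps V -> vc2 V -> apex V v -> steps (v |: V).
Proof.
move=> sV v2 av.
have tow := apex_toward sV v2 av.
have stp A B : A \in V -> B \in V -> A != B ->
    exists2 i, i \in sep A B & flip A i \in v |: V.
  by move=> VA VB /(sV A B VA VB)[i iAB Vi]; exists i; rewrite ?setU1r.
move=> A B /setU1P[->|VA] /setU1P[->|VB] neq.
- by rewrite eqxx in neq.
- by have [r rB Vr] := tow B VB; exists r; rewrite ?setU1r.
(* To go from [A] to [v], aim at the neighbour [flip v r] of [v], which lies between them. *)
- have [r rA Vr] := tow A VA.
  have [E|nE] := eqVneq A (flip v r).
    by exists r; rewrite ?[sep A v]sepC // E flipK setU11.
  have [i iA Vi] := stp A _ VA Vr nE; exists i => //.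
  move: iA; rewrite sep_flipr inE sepC; case: eqP => [-> //|_].
  by rewrite addbF sepC.
exact: stp.
Qed.

Lemma apex_vc2 V v : vc2 V -> apex V v -> vc2 (v |: V).
Proof.
move=> v2 /andP[Vv N4] x i j k nij nik njk sh.
have [l Nl [nli nlj nlk]] := card_avoid3 i j k N4.
apply: (v2 x i j k) => // a b c.
(* Some neighbour of [v] in [V] has the same trace as [v] on [i, j, k]. *)
have [A /setU1P[->|VA]] := sh a b c; last by exists A.
rewrite inE in Nl; exists (flip v l) => //.
have e y : l != y -> (y \in sep x (flip v l)) = (y \in sep x v).
  by rewrite sep_flipr eq_sym inE => /negPf->; rewrite addbF.
by rewrite !e.
Qed.

(** The witness is the coordinatewise majority of [A], [B] and [C]. *)
Lemma median_adj A B C : #|sep A B| = 2 -> #|sep A C| = 2 -> #|sep B C| = 2 ->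
  exists v, [/\ cube_adj v A, cube_adj v B & cube_adj v C].
Proof.
move=> AB AC BC; have := card_sep (sep A B) (sep A C).
rewrite sep_sep AB AC BC => cI.
have {}cI : #|sep A B :&: sep A C| = 1 by lia.
exists (sep A (sep A B :&: sep A C)); rewrite ![cube_adj _ A]cube_adjC.
rewrite ![cube_adj _ B]cube_adjC ![cube_adj _ C]cube_adjC !cube_adjE sepK cI.
split=> //.
  have -> : sep B (sep A (sep A B :&: sep A C)) = sep A B :\: sep A C.
    by apply/setP=> i; rewrite !inE; do 3!case: (_ \in _).
  by rewrite cardsD AB cI.
have -> : sep C (sep A (sep A B :&: sep A C)) = sep A C :\: sep A B.
  by apply/setP=> i; rewrite !inE; do 3!case: (_ \in _).
by rewrite cardsD setIC AC cI.
Qed.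

Lemma common_nbr A B w : #|sep A B| = 2 -> cube_adj w A -> cube_adj w B ->
  exists2 i, i \in sep A B & w = flip A i.
Proof.
move=> AB; rewrite cube_adjC => /cube_adjP[i ->]; rewrite cube_adjE => wB.
exists i => //; apply: contraTT wB => niAB.
have -> : sep (flip A i) B = i |: sep A B.
  apply/setP=> j; rewrite !inE; case: eqP => [->|_]; last by rewrite addbF.
  by move: niAB; rewrite inE; do 2!case: (_ \in _).
by rewrite cardsU1 niAB AB.
Qed.

(** A common neighbour flips one of the two coordinates that separate [A] from [B]; once [w2] is
    excluded, one choice is left. *)
Lemma common_nbr_uniq A B w1 w2 w3 : #|sep A B| = 2 ->
  cube_adj w1 A -> cube_adj w1 B -> cube_adj w2 A -> cube_adj w2 B ->
  cube_adj w3 A -> cube_adj w3 B -> w1 != w2 -> w3 != w2 -> w1 = w3.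
Proof.
move=> AB A1 B1 A2 B2 A3 B3.
have [a aAB ->] := common_nbr AB A1 B1.
have [b bAB ->] := common_nbr AB A2 B2.
have [c cAB ->] := common_nbr AB A3 B3.
rewrite !(inj_eq (@flip_inj _ _)) => nab ncb.
apply/eqP; rewrite (inj_eq (@flip_inj _ _)); apply: contraTT (leqnn 2).
rewrite -{1}AB -ltnNge => nac; apply/card_gt2P; exists a, b, c.
by split; split; rewrite // eq_sym.
Qed.

Lemma adj_flip3 v w i j k : i != j -> i != k -> j != k ->
  cube_adj w (flip v i) -> cube_adj w (flip v j) -> cube_adj w (flip v k) ->
  w = v.
Proof.
move=> nij nik njk wi wj wk.
have sE : sep (flip v i) (flip v j) = [set i; j].
  apply/setP=> l; rewrite !inE; case: (_ \in _);
  by case: (eqVneq l i) nij => [-> /negPf->|_ _]; do ?case: eqP.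
have c2 : #|sep (flip v i) (flip v j)| = 2 by rewrite sE cards2 nij.
have vi a : cube_adj v (flip v a) by apply: cube_adj_flip.
have nk : ~~ cube_adj (flip (flip v i) j) (flip v k).
  rewrite cube_adjE.
  have -> : sep (flip (flip v i) j) (flip v k) = k |: [set i; j].
    apply/setP=> l; rewrite !inE; case: (_ \in _);
    have [->|_] := eqVneq l i; rewrite ?(negPf nij) ?(negPf nik) ?orbT //;
    have [->|_] := eqVneq l j; rewrite ?(negPf njk) ?orbT //; by case: eqP.
  by rewrite cardsU1 cards2 nij !inE negb_or ![k == _]eq_sym nik njk.
apply: (@common_nbr_uniq (flip v i) (flip v j) _ (flip (flip v i) j)) => //.
- by rewrite cube_adjC; apply: cube_adj_flip.
- by rewrite flipC cube_adjC; apply: cube_adj_flip.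
- by apply: contraNneq nk => <-.
- by apply: contraNneq nk => <-.
Qed.

(** * Full subdivisions *)

Section Subdivision.

Definition SK_mid n (A : {set 'I_n}) (cA : #|A| == 2) : SK_vertex n :=
  inr (exist (fun B : {set 'I_n} => #|B| == 2) A cA).

Variables (n : nat) (H : {set {set 'I_m}}) (f : SK_vertex n -> {set 'I_m}).
Hypothesis isoH : graph_iso (@SK_adj n) setT (@cube_adj m) H f.

Lemma SK_inj : injective f.
Proof. by case: isoH => inj _ _ u w; apply: inj; rewrite in_setT. Qed.

Lemma SK_in u : f u \in H.
Proof. by case: isoH => _ <- _; rewrite imset_f ?in_setT. Qed.

Lemma SK_adjE u u' : cube_adj (f u) (f u') = SK_adj u u'.
Proof. by case: isoH => _ _ ->; rewrite ?in_setT. Qed.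

Lemma SK_onto A : A \in H -> exists u, A = f u.
Proof. by case: isoH => _ <- _ /imsetP[u _ ->]; exists u. Qed.

Lemma SK_orig_adj v (i j : 'I_n) : i != j ->
  cube_adj v (f (inl i)) -> cube_adj v (f (inl j)) ->
  #|sep (f (inl i)) (f (inl j))| = 2.
Proof.
move=> nij /cube_adjP[a Ea] /cube_adjP[b Eb]; rewrite Ea Eb.
have nab : a != b.
  apply: contraNneq nij => E; have /SK_inj[->] // : f (inl i) = f (inl j).
  by rewrite Ea Eb E.
have -> : sep (flip v a) (flip v b) = [set a; b].
  apply/setP=> l; rewrite !inE; case: (_ \in _);
  by case: (eqVneq l a) nab => [-> /negPf->|_ _]; do ?case: eqP.
by rewrite cards2 nab.
Qed.

Lemma SK_orig_dist (i j : 'I_n) : i != j ->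
  #|sep (f (inl i)) (f (inl j))| = 2.
Proof.
move=> nij; have c2 : #|[set i; j]| == 2 by rewrite cards2 nij.
pose s := SK_mid c2.
by apply: (@SK_orig_adj (f s)); rewrite // SK_adjE /= !inE eqxx ?orbT.
Qed.

(** The first two original vertices have two common neighbours, one of which subdivides their edge
    and is adjacent to no other original vertex. The median with any third original vertex is
    therefore always the other one. *)
Lemma SK_apex_exists : 3 <= n -> exists v, forall i : 'I_n, cube_adj v (f (inl i)).
Proof.
move=> n3; have n2 := ltnW n3; have n1 := ltnW n2.
pose i0 := Ordinal n1; pose i1 := Ordinal n2; pose i2 := Ordinal n3.
have c2 : #|[set i0; i1]| == 2 by rewrite cards2.
pose s := SK_mid c2.
have sN (k : 'I_n) : k != i0 -> k != i1 -> ~~ cube_adj (f s) (f (inl k)).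
  by move=> k0 k1; rewrite SK_adjE /= !inE negb_or k0 k1.
have med (k : 'I_n) : k != i0 -> k != i1 -> exists v, [/\ cube_adj v (f (inl i0)),
    cube_adj v (f (inl i1)) & cube_adj v (f (inl k))].
  by move=> k0 k1; apply: median_adj; apply: SK_orig_dist; rewrite // eq_sym.
have [v [v0 v1 v2]] : exists v, [/\ cube_adj v (f (inl i0)),
    cube_adj v (f (inl i1)) & cube_adj v (f (inl i2))] by apply: med.
exists v => k; have [->//|k0] := eqVneq k i0; have [->//|k1] := eqVneq k i1.
have [w [w0 w1 wk]] := med k k0 k1; suff -> : v = w by [].
have c01 : #|sep (f (inl i0)) (f (inl i1))| = 2 by apply: SK_orig_dist.
apply: (@common_nbr_uniq _ _ _ (f s) _ c01) => //.
- by rewrite SK_adjE /= !inE eqxx.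
- by rewrite SK_adjE /= !inE eqxx orbT.
- by apply: contraTneq v2 => ->; apply: sN.
- by apply: contraTneq wk => ->; apply: sN.
Qed.

(** If [v] were in [V], it would lie on a geodesic between two original vertices, hence in [H] by
    convexity; but no vertex of [SK_n] is adjacent to all original ones. *)
Lemma SK_apex V v : steps V -> H \subset V -> convex (@cube_adj m) H V ->
  4 <= n -> (forall i : 'I_n, cube_adj v (f (inl i))) -> apex V v.
Proof.
move=> sV sHV [_ cH] n4 av; apply/andP; split; last first.
  rewrite -(card_imset _ (@flip_inj _ v)) (leq_trans n4) //.
  have inj : injective (fun i : 'I_n => f (inl i)) by move=> ? ? /SK_inj[].
  rewrite -[X in X <= _](card_ord n) -(card_imset _ inj).
  apply/subset_leq_card/subsetP => _ /imsetP[i _ ->].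
  have /cube_adjP[a Ea] := av i; rewrite Ea imset_f // inE -Ea.
  exact: (subsetP sHV) (SK_in _).
apply/negP=> Vv; have n2 := ltnW (ltnW n4); have n1 := ltnW n2.
pose i0 := Ordinal n1; pose i1 := Ordinal n2.
have H0 : f (inl i0) \in H by apply: SK_in.
have H1 : f (inl i1) \in H by apply: SK_in.
have V0 := subsetP sHV _ H0; have V1 := subsetP sHV _ H1.
have sp : shortest_path (@cube_adj m) V (f (inl i0)) (f (inl i1)) [:: v; f (inl i1)].
  apply/steps_shortest => //; split; last first.
    by rewrite (SK_orig_adj (isT : i0 != i1) (av _) (av _)).
  split=> //=; first by rewrite cube_adjC !av.
  by move=> A; rewrite !inE => /or3P[] /eqP->.
have /SK_onto[u Eu] : v \in H by apply: cH sp _ _ => //; rewrite inE eqxx.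
have au (i : 'I_n) : SK_adj u (inl i) by rewrite -SK_adjE -Eu.
case: u Eu au => [i|[A /= cA]] _ au; first by have := au i.
have : [set: 'I_n] \subset A by apply/subsetP=> i _; apply: au.
by move/subset_leq_card; rewrite cardsT card_ord (eqP cA); lia.
Qed.

End Subdivision.

End Apex.

(** * The subdivision spanned by the neighbours of a missing vertex *)

Section Completion.

Variable m : nat.
Implicit Types (A B C D T S v w : {set 'I_m}) (V W H : {set {set 'I_m}}).
Implicit Types (i j k : 'I_m).

Definition SK_family V v : {set {set 'I_m}} :=
  [set A | (sep v A \subset nbr V v) && (0 < #|sep v A| <= 2)].

(** Realises [SK_n] in the cube on [n] points as the singletons and pairs, so that its adjacency
    becomes cube adjacency. *)
Definition SK_code n (u : SK_vertex n) : {set 'I_n} :=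
  match u with inl i => [set i] | inr A => val A end.

Definition SK_embed V v (u : SK_vertex #|nbr V v|) : {set 'I_m} :=
  sep v [set enum_val i | i in SK_code u].

Lemma SK_code_inj n : injective (@SK_code n).
Proof.
move=> [i|A] [j|B] /= E.
- by rewrite (set1_inj E).
- by have := valP B; rewrite /= -E cards1.
- by have := valP A; rewrite /= E cards1.
- by congr inr; apply: val_inj.
Qed.

Lemma SK_adj_code n (u w : SK_vertex n) :
  SK_adj u w = cube_adj (SK_code u) (SK_code w).
Proof.
rewrite cube_adjE; case: u w => [i|A] [j|B] /=.
- have := card_sep [set i] [set j]; rewrite !cards1.
  by case: eqP => // ->; lia.
- have := card_sep [set i] (val B); rewrite cards1 (eqP (valP B)).
  have -> : [set i] :&: val B = if i \in val B then [set i] else set0.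
    apply/setP=> k; rewrite !inE; have [->|nki] := eqVneq k i.
      by case: ifP; rewrite !inE ?eqxx.
    by case: ifP; rewrite !inE ?(negPf nki).
  move: #|sep _ _| => s.
  by case: ifP => _; rewrite ?cards1 ?cards0; case: eqP; lia.
- have := card_sep (val A) [set j]; rewrite cards1 (eqP (valP A)) setIC.
  have -> : [set j] :&: val A = if j \in val A then [set j] else set0.
    apply/setP=> k; rewrite !inE; have [->|nkj] := eqVneq k j.
      by case: ifP; rewrite !inE ?eqxx.
    by case: ifP; rewrite !inE ?(negPf nkj).
  move: #|sep _ _| => s.
  by case: ifP => _; rewrite ?cards1 ?cards0; case: eqP; lia.
- have := card_sep (val A) (val B); rewrite (eqP (valP A)) (eqP (valP B)).
  by case: eqP => // ->; lia.
Qed.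

Lemma SK_embed_orig V v (i : 'I_#|nbr V v|) :
  SK_embed (inl i : SK_vertex _) = flip v (enum_val i) :> {set 'I_m}.
Proof. by rewrite /SK_embed /= imset_set1; apply/setP=> j; rewrite !inE. Qed.


Lemma sep_imset n (g : 'I_n -> 'I_m) (X Y : {set 'I_n}) : injective g ->
  sep (g @: X) (g @: Y) = g @: sep X Y.
Proof.
move=> inj; apply/setP=> a; rewrite inE.
have memg (Z : {set 'I_n}) (i : 'I_n) : (g i \in g @: Z) = (i \in Z) by apply: mem_imset.
have [/codomP[i ->]|na] := boolP (a \in codom g); first by rewrite !memg inE.
have nZ (Z : {set 'I_n}) : (a \in g @: Z) = false.
  by apply: contraNF na => /imsetP[i _ ->]; apply: codom_f.
by rewrite !nZ.
Qed.

Lemma SK_family_iso V v : graph_iso (@SK_adj #|nbr V v|) setT (@cube_adj m)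
  (SK_family V v) (@SK_embed V v).
Proof.
have einj : injective (@enum_val _ (mem (nbr V v))) by apply: enum_val_inj.
split.
- move=> u w _ _ /(congr1 (sep v)); rewrite !sepK => /(imset_inj einj).
  exact: SK_code_inj.
- apply/setP=> A; apply/imsetP/idP => [[u _ ->]|].
    rewrite inE /SK_embed sepK card_imset //; apply/andP; split.
      by apply/subsetP=> _ /imsetP[i _ ->]; apply: enum_valP.
    by case: u => [i|B] /=; rewrite ?cards1 // (eqP (valP B)).
  rewrite inE => /andP[sub cA].
  pose X : {set 'I_#|nbr V v|} := [set i | enum_val i \in sep v A].
  have XE : [set enum_val i | i in X] = sep v A.
    apply/setP=> a; apply/imsetP/idP => [[i]|aA]; first by rewrite inE => ? ->.
    exists (enum_rank_in (subsetP sub _ aA) a).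
      by rewrite inE enum_rankK_in // (subsetP sub).
    by rewrite enum_rankK_in // (subsetP sub).
  have cX : 0 < #|X| <= 2 by rewrite -(card_imset _ einj) XE.
  suff [u Eu] : exists u : SK_vertex #|nbr V v|, SK_code u = X.
    by exists u; rewrite ?in_setT // /SK_embed Eu XE sepK.
  have [c2|nc2] := eqVneq #|X| 2.
    by exists (SK_mid (introT eqP c2)).
  have /cards1P[i ->] : #|X| == 1 by lia.
  by exists (inl i).
move=> u w _ _; rewrite SK_adj_code !cube_adjE /SK_embed sep_sep.
by rewrite sep_imset // card_imset.
Qed.

Lemma SK_family_sub V v : steps V -> v \notin V -> SK_family V v \subset V.
Proof.
move=> sV Vv; apply/subsetP=> A; rewrite inE => HA; rewrite -[A](sepK v).
move: (sep v A) HA => X /andP[sXN cX].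
have [c2|nc2] := eqVneq #|X| 2.
  have /cards2P[i [j [nij E]]] : #|X| == 2 by apply/eqP.
  have -> : sep v X = flip (flip v i) j.
    rewrite E; apply/setP=> a; rewrite !inE -addbA; congr (_ (+) _).
    by case: (eqVneq a i) nij => [-> /negPf->|].
  by apply: nbr_pair => //; apply: (subsetP sXN); rewrite E !inE eqxx ?orbT.
have /cards1P[i E] : #|X| == 1 by lia.
have : i \in nbr V v by apply: (subsetP sXN); rewrite E inE.
rewrite inE E; congr (_ \in V); apply/setP=> a; by rewrite !inE.
Qed.

Lemma SK_family_steps V v : steps (SK_family V v).
Proof.
have sepf A i : sep v (flip A i) = sep (sep v A) [set i].
  by apply/setP=> a; rewrite !inE addbA.
move=> A B; rewrite !inE => /andP[sA cA] /andP[sB cB] nAB.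
have nE : sep v A != sep v B.
  by apply: contra nAB => /eqP/(congr1 (sep v)); rewrite !sepK => ->.
have [c2|nc2] := eqVneq #|sep v A| 2.
  have /subsetPn[i iA iB] : ~~ (sep v A \subset sep v B).
    by apply: contra nE => sAB; rewrite eqEcard sAB c2; lia.
  have dE : sep v (flip A i) = sep v A :\ i.
    rewrite sepf; apply/setP=> a; rewrite !inE; have [->|_] := eqVneq a i.
      by move: iA; rewrite inE => ->.
    by rewrite addbF.
  exists i; first by rewrite -(sep_sep v) inE iA (negPf iB).
  rewrite inE dE (subset_trans (subsetDl _ _) sA) /=.
  by have := cardsD1 i (sep v A); rewrite iA c2 add1n => -[<-].
have /subsetPn[i iB iA] : ~~ (sep v B \subset sep v A).
  by apply: contra nE => sBA; rewrite eq_sym eqEcard sBA; lia.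
have dE : sep v (flip A i) = i |: sep v A.
  rewrite sepf; apply/setP=> a; rewrite !inE; have [->|_] := eqVneq a i.
    by move: iA; rewrite inE => /negPf->.
  by rewrite addbF.
exists i; first by rewrite -(sep_sep v) inE iB (negPf iA).
rewrite inE dE subUset sub1set (subsetP sB) // sA /= cardsU1 iA; lia.
Qed.

(** A vertex between two members differs from [v] only in directions of [nbr V v], in at most two of
    them by [apex_card_sep], and in at least one since [v] is missing. *)
Lemma SK_family_convex V v : steps V -> vc2 V -> apex V v ->
  convex (@cube_adj m) (SK_family V v) V.
Proof.
move=> sV v2 av; have /andP[Vv _] := av.
have sub := SK_family_sub sV Vv; split=> // A B HA HB p sp C Cp.
have [VA VB] := (subsetP sub _ HA, subsetP sub _ HB).
have VC : C \in V.
  case: sp => -[_ sp _] _; apply: sp; by rewrite inE Cp orbT.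
have sAC := shortest_between sV VA VB sp Cp.
have sC : sep v C \subset nbr V v.
  move: HA HB; rewrite !inE => /andP[/subsetP sA _] /andP[/subsetP sB _].
  apply/subsetP=> a aC; have [/sA//|aA] := boolP (a \in sep v A).
  apply: sB; have := subsetP sAC a; move: aC aA.
  by rewrite !inE; do 4!case: (_ \in _) => //; move=> _ _ /(_ isT).
rewrite inE sC /= -{2}(setIidPl sC) apex_card_sep // andbT.
by rewrite card_gt0 sep_eq0; apply: contraNneq Vv => ->.
Qed.

Lemma SK_family_maximal V v : steps V -> vc2 V -> apex V v ->
  maximal_convex_full_subdivision V (SK_family V v) (@SK_embed V v).
Proof.
move=> sV v2 av; have /andP[Vv N4] := av.
have sub := SK_family_sub sV Vv; split.
  split; [exact: SK_family_convex | | exact: SK_family_iso].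
  exact: steps_isometric (@SK_family_steps V v) sV.
move=> n H f [cH isoH iso] sH.
apply/eqP; rewrite eqEsubset sH andbT.
have sHV : H \subset V by case: cH.
have HN i : i \in nbr V v -> flip v i \in H.
  move=> Ni; apply: (subsetP sH); rewrite inE sep_flip sub1set Ni cards1.
  by [].
have HN2 i j : i \in nbr V v -> j \in nbr V v -> i != j -> flip (flip v i) j \in H.
  move=> Ni Nj nij; apply: (subsetP sH); rewrite inE.
  have -> : sep v (flip (flip v i) j) = [set i; j].
    apply/setP=> a; rewrite !sep_flipr sepxx !inE.
    by case: (eqVneq a i) nij => [-> /negPf->|].
  by rewrite subUset !sub1set Ni Nj cards2 nij.
(* A subdividing vertex has degree two, while [flip v i] has at least three neighbours in [H], one
   for each further direction of [nbr V v]. *)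
have orig i : i \in nbr V v -> exists a : 'I_n, flip v i = f (inl a).
  move=> Ni; have [[a|A]] := SK_onto iso (HN i Ni); first by exists a.
  move=> Ei; have /card_gt2P[j [k [l]]] : 2 < #|nbr V v :\ i|.
    by move: N4; rewrite (cardsD1 i) Ni.
  rewrite !in_setD1 => -[[/andP[nji Nj] /andP[nki Nk] /andP[nli Nl]] [njk nkl nlj]].
  have mid j0 : j0 != i -> j0 \in nbr V v ->
      exists2 a, a \in val A & flip (flip v i) j0 = f (inl a).
    move=> nj0 Nj0; have := HN2 i j0 Ni Nj0; rewrite eq_sym => /(_ nj0).
    move=> /(SK_onto iso)[u Eu].
    have := cube_adj_flip (flip v i) j0; rewrite Eu Ei (SK_adjE iso).
    by case: u Eu => [a|B] Eu //= aA; exists a.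
  have [a aA Ea] := mid j nji Nj; have [b bA Eb] := mid k nki Nk.
  have [c cA Ec] := mid l nli Nl.
  have neq x y x' y' : x != y -> flip (flip v i) x = f (inl x') ->
      flip (flip v i) y = f (inl y') -> x' != y'.
    move=> nxy Ex Ey; apply: contraNneq nxy => E.
    by apply/eqP/(@flip_inj _ (flip v i)); rewrite Ex Ey E.
  suff : 2 < #|val A| by rewrite (eqP (valP A)).
  apply/card_gt2P; exists a, b, c; do 2!split=> //.
  - exact: neq njk Ea Eb.
  - exact: neq nkl Eb Ec.
  - exact: neq nlj Ec Ea.
have n4 : 4 <= n.
  apply: leq_trans N4 _; rewrite -(card_imset _ (@flip_inj _ v)).
  have inj : injective (fun i : 'I_n => f (inl i)) by move=> ? ? /(SK_inj iso)[].
  rewrite -[X in _ <= X](card_ord n) -(card_imset _ inj).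
  apply/subset_leq_card/subsetP => _ /imsetP[i Ni ->].
  by have [a ->] := orig i Ni; apply: imset_f.
have [w aw] := SK_apex_exists iso (ltnW n4).
(* So every original vertex of [H] is a neighbour of [v], and [H] cannot exceed the family. *)
have wv : w = v.
  have /card_gt2P[i [j [k [[Ni Nj Nk] [nij njk nki]]]]] := ltnW N4.
  have nik : i != k by rewrite eq_sym.
  have adj l : l \in nbr V v -> cube_adj w (flip v l) by move=> /orig[a ->].
  exact: adj_flip3 nij nik njk (adj _ Ni) (adj _ Nj) (adj _ Nk).
subst w.
have origN a : exists2 i, i \in nbr V v & f (inl a) = flip v i.
  have /cube_adjP[i Ei] := aw a; exists i => //.
  by rewrite inE -Ei (subsetP sHV) // (SK_in iso).
apply/subsetP=> A HA; have [[a|B] EA] := SK_onto iso HA.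
  have [i Ni Ei] := origN a.
  by rewrite EA Ei inE sep_flip sub1set Ni cards1.
have /cards2P[a [b [nab EB]]] := valP B.
have [i Ni Ei] := origN a; have [j Nj Ej] := origN b.
have Aa : cube_adj (f (inr B)) (f (inl a)).
  by rewrite (SK_adjE iso) /= EB !inE eqxx.
have Ab : cube_adj (f (inr B)) (f (inl b)).
  by rewrite (SK_adjE iso) /= EB !inE eqxx orbT.
have nij : i != j.
  apply: contraNneq nab => E.
  by have /(SK_inj iso)[->] : f (inl a) = f (inl b) by rewrite Ei Ej E.
have c2 : #|sep (flip v i) (flip v j)| = 2 by rewrite -Ei -Ej (SK_orig_dist iso).
have VA : A \in V := subsetP sHV _ HA.
have nA : A != v by apply: contraNneq Vv => <-.
have : A = flip (flip v i) j.
  apply: (@common_nbr_uniq _ (flip v i) (flip v j) _ v) => //.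
  - by rewrite EA -Ei.
  - by rewrite EA -Ej.
  - exact: cube_adj_flip.
  - exact: cube_adj_flip.
  - by rewrite cube_adjC cube_adj_flip.
  - by rewrite cube_adjC flipC cube_adj_flip.
  - by apply: contraNneq (Vv) => E; rewrite -[X in X \in V]E; apply: nbr_pair.
move=> ->; rewrite inE.
have -> : sep v (flip (flip v i) j) = [set i; j].
  apply/setP=> c; rewrite !sep_flipr sepxx !inE.
  by case: (eqVneq c i) nij => [-> /negPf->|].
by rewrite subUset !sub1set Ni Nj cards2 nij.
Qed.

End Completion.

(** * The completion *)

Section Confluence.

Variable m : nat.
Implicit Types (A B C D T S v w : {set 'I_m}) (V W H : {set {set 'I_m}}).
Implicit Types (i j k : 'I_m).

Lemma two_dimensional_apex V v :
  two_dimensional V -> apex V v -> two_dimensional (v |: V).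
Proof.
move=> /two_dimensionalP[V0 sV v2] av; apply/two_dimensionalP; split.
- by apply/set0Pn; exists v; rewrite setU11.
- exact: apex_steps.
- exact: apex_vc2.
Qed.

Lemma one_extensionP V W : two_dimensional V ->
  one_extension V W <-> exists2 v, apex V v & W = v |: V.
Proof.
move=> tV; have /two_dimensionalP[V0 sV v2] := tV; split.
  move=> [_ [n [H [f [v [n4 [[cH _ iso] _] [av _] ->]]]]]]; exists v => //.
  exact: (SK_apex iso sV) (cH.1) cH n4 av.
move=> [v av ->]; split=> //.
exists #|nbr V v|, (SK_family V v), (@SK_embed _ V v), v; split=> //.
- by case/andP: av.
- exact: SK_family_maximal.
have ev a : a \in nbr V v -> exists i : 'I_#|nbr V v|, enum_val i = a.
  by move=> Na; exists (enum_rank_in Na a); rewrite enum_rankK_in.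
split=> [i|w aw]; first by rewrite SK_embed_orig cube_adj_flip.
have {}aw a : a \in nbr V v -> cube_adj w (flip v a).
  by move=> /ev[i <-]; rewrite -SK_embed_orig.
have /andP[_ N4] := av.
have /card_gt2P[i [j [k [[Ni Nj Nk] [nij njk nki]]]]] := ltnW N4.
have nik : i != k by rewrite eq_sym.
by rewrite (adj_flip3 nij nik njk (aw _ Ni) (aw _ Nj) (aw _ Nk)).
Qed.

Lemma no_subdivisionP V : two_dimensional V ->
  (forall n H (f : SK_vertex n -> {set 'I_m}),
     4 <= n -> ~ convex_full_subdivision V H f) <->
  (forall v, ~~ apex V v).
Proof.
move=> /two_dimensionalP[V0 sV v2]; split=> [no v|no n H f n4 [cH _ iso]].
  apply/negP=> av; have [sub _] := SK_family_maximal sV v2 av.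
  by apply: no sub; case/andP: av.
have [v av] := SK_apex_exists iso (ltnW n4).
by have := SK_apex iso sV (cH.1) cH n4 av; apply/negP.
Qed.

Lemma one_extensions_props n V W : two_dimensional V -> one_extensions n V W ->
  [/\ two_dimensional W, V \subset W & #|W| = #|V| + n].
Proof.
elim: n V => [|n IH] V tV /=; first by move=> <-; rewrite addn0.
case=> V' /(one_extensionP _ tV)[v av ->] /IH[|tW sW ->].
  exact: two_dimensional_apex.
split=> //; first exact: subset_trans (subsetUr _ _) sW.
by rewrite cardsU1; case/andP: av => -> _; rewrite add1n addSnnS.
Qed.

(** An apex of a subfamily of [U] keeps its four neighbours in [U], so it must belong to [U].
    Applied to two completions in both directions, this gives their equality. *)
Lemma one_extensions_sub n V W U : two_dimensional V -> one_extensions n V W ->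
  (forall v, ~~ apex U v) -> V \subset U -> W \subset U.
Proof.
move=> + + cU; elim: n V => [|n IH] V tV /=; first by move=> <-.
case=> V' /(one_extensionP _ tV)[v av ->] eW sVU.
apply: (IH _ (two_dimensional_apex tV av) eW).
rewrite subUset sub1set sVU andbT; have := cU v; apply: contraR => Uv.
rewrite /apex Uv; case/andP: av => _ /leq_trans; apply.
apply/subset_leq_card/subsetP=> i; rewrite !inE; exact: (subsetP sVU).
Qed.

Lemma one_completion_exists V : two_dimensional V ->
  exists n W, one_completion n V W.
Proof.
move En : #|~: V| => n; elim: n {-2}n (leqnn n) V En => [|n IH] d led V En tV.
  exists 0, V; split=> //; apply/(no_subdivisionP tV) => v.
  have V0 : ~: V = set0 by apply/eqP; rewrite -cards_eq0 En -leqn0.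
  by rewrite /apex -in_setC V0 inE.
have [/existsP[v av]|/existsPn no] := boolP [exists v, apex V v]; last first.
  by exists 0, V; split=> //; apply/(no_subdivisionP tV).
have Vv : v \in ~: V by rewrite inE; case/andP: av.
have [|k [W [eW cW]]] := IH #|~: (v |: V)| _ _ erefl (two_dimensional_apex tV av).
  rewrite setCU setIC -setDE -ltnS; apply: leq_trans led.
  by rewrite -En (cardsD1 v (~: V)) Vv.
exists k.+1, W; split=> //=; exists (v |: V) => //.
by apply/(one_extensionP _ tV); exists v.
Qed.

End Confluence.

(** * The Sauer-Shelah inequality *)

Section SauerShelah.

Variable m : nat.
Implicit Types (A X Y : {set 'I_m}) (V : {set {set 'I_m}}) (y : 'I_m).

Lemma shatters_notin V X y : {in V, forall A, y \notin A} -> shatters V X ->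
  y \notin X.
Proof.
move=> nV /shattersP/(_ X (subxx _))[A VA XA]; rewrite -XA inE negb_and.
by rewrite (nV A VA) orbT.
Qed.

(** Pajor's form of the inequality, by induction on a ground set [Y] containing all members. Split
    [V] at [y] into [V0] and [V1]: a set shattered by either half is shattered by [V], and one
    shattered by both counts a second time with [y] added. *)
Lemma card_le_shatters V : #|V| <= #|[set X | shatters V X]|.
Proof.
suff H n Y : #|Y| = n -> forall V, {in V, forall A, A \subset Y} ->
    #|V| <= #|[set X | shatters V X]|.
  by apply: (H _ setT erefl) => A _; apply: subsetT.
elim: n Y => [|n IH] Y cY {}V sVY.
  have [->|/set0Pn[B VB]] := eqVneq V set0; first by rewrite cards0.
  apply: (@leq_trans #|[set set0 : {set 'I_m}]|).
    apply/subset_leq_card/subsetP=> A /sVY.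
    by rewrite (cards0_eq cY) subset0 inE.
  rewrite cards1 card_gt0; apply/set0Pn; exists set0; rewrite inE.
  by apply/shattersP=> Z; rewrite subset0 => /eqP->; exists B; rewrite ?set0I.
have /card_gt0P[y Yy] : 0 < #|Y| by rewrite cY.
have cY' : #|Y :\ y| = n by move: cY; rewrite (cardsD1 y) Yy => -[].
pose V0 := [set A in V | y \notin A].
pose V1 := [set A :\ y | A in [set A in V | y \in A]].
have mV1 A : A \in V1 -> y \notin A /\ y |: A \in V.
  by case/imsetP=> B; rewrite inE => /andP[VB yB] ->; rewrite setD1K // !inE eqxx.
have E1 : #|V| = #|V0| + #|V1|.
  have inj1 : {in [set A in V | y \in A] &, injective (fun A => A :\ y)}.
    move=> A B; rewrite !inE => /andP[_ yA] /andP[_ yB] E.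
    by rewrite -(setD1K yA) E setD1K.
  rewrite (card_in_imset inj1) addnC -(cardsID [set A : {set 'I_m} | y \in A] V).
  by congr (_ + _); apply: eq_card => A; rewrite !inE andbC.
have IH0 : #|V0| <= #|[set X | shatters V0 X]|.
  apply: (IH _ cY') => A; rewrite inE => /andP[VA yA].
  by rewrite subsetD1 yA sVY.
have IH1 : #|V1| <= #|[set X | shatters V1 X]|.
  apply: (IH _ cY') => A /mV1[yA VA]; rewrite subsetD1 yA andbT.
  exact: subset_trans (subsetUr _ _) (sVY _ VA).
set S0 := [set X | _] in IH0; set S1 := [set X | _] in IH1.
have y0 X : X \in S0 -> y \notin X.
  by rewrite inE; apply: shatters_notin => A; rewrite inE => /andP[].
have y1 X : X \in S1 -> y \notin X.
  by rewrite inE; apply: shatters_notin => A /mV1[].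
rewrite E1 (leq_trans (leq_add IH0 IH1)) // -cardsUI.
have inj : {in S0 :&: S1 &, injective (fun X => y |: X)}.
  move=> A B /setIP[/y0 yA _] /setIP[/y0 yB _] E.
  by rewrite -(setU1K yA) E setU1K.
rewrite -(card_in_imset inj) -cardsUI.
have -> : (S0 :|: S1) :&: [set y |: X | X in S0 :&: S1] = set0.
  apply/setP=> X; rewrite in_set0; apply/negP.
  move=> /setIP[/setUP X01 /imsetP[Z _ EX]].
  have : y \notin X by case: X01 => [/y0|/y1].
  by rewrite EX setU11.
rewrite cards0 addn0; apply/subset_leq_card/subsetP=> X.
have memU1 A (Z : {set 'I_m}) : y \notin Z -> Z :&: (y |: A) = Z :&: A.
  move=> yZ; apply/setP=> z; rewrite !inE; case: eqP => [->|//].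
  by rewrite (negPf yZ).
case/setUP=> [/setUP[]|/imsetP[Z /setIP[Z0 Z1] ->]]; rewrite !inE.
- move/shattersP=> sX; apply/shattersP=> Z /sX[A]; rewrite inE.
  by case/andP; exists A.
- move=> sX; have yX : y \notin X by apply: y1; rewrite inE.
  apply/shattersP=> Z /(shattersP _ _ sX)[A /mV1[_ VA] E].
  by exists (y |: A); rewrite ?memU1.
have yZ := y0 _ Z0; move: Z0 Z1; rewrite !inE => /shattersP Z0 /shattersP Z1.
apply/shattersP=> X' sX'.
have sZ : X' :\ y \subset Z by rewrite subDset.
have [yX|yX] := boolP (y \in X').
  have [A /mV1[yA VA] E] := Z1 _ sZ; exists (y |: A) => //.
  by rewrite -setUIr E setD1K.
have [A] := Z0 _ sZ; rewrite inE => /andP[VA yA] E; exists A => //.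
rewrite setIC memU1 // setIC E; apply/setDidPl.
by rewrite disjoint_sym disjoints1.
Qed.

Lemma card_vc2 V : vc2 V -> #|V| <= 'C(m, 0) + 'C(m, 1) + 'C(m, 2).
Proof.
move=> v2; apply: leq_trans (card_le_shatters V) _.
pose S d := [set X : {set 'I_m} | #|X| == d].
have cS d : #|S d| = 'C(m, d) by rewrite card_draws card_ord.
have cU (X Y : {set {set 'I_m}}) : #|X :|: Y| <= #|X| + #|Y|.
  by rewrite cardsU leq_subr.
rewrite -!cS; apply: (@leq_trans #|S 0 :|: S 1 :|: S 2|); last first.
  by apply: leq_trans (cU _ _) _; rewrite leq_add2r cU.
apply/subset_leq_card/subsetP=> X; rewrite !inE => sX.
have : #|X| <= 2.
  by apply: leq_trans (proj2 (vc_dim_vc2 V) v2); apply: leq_bigmax_cond sX.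
by case: #|X| => [|[|[|]]].
Qed.

End SauerShelah.

Lemma canonical_completion_exists m (V : {set {set 'I_m}}) :
  two_dimensional V -> exists W,
    [/\ canonical_completion ('C(m, 0) + 'C(m, 1) + 'C(m, 2)) V W,
        two_dimensional W, forall v, ~~ apex W v & V \subset W].
Proof.
move=> tV; have [n [W [eW nW]]] := one_completion_exists tV.
have [tW sVW _] := one_extensions_props tV eW.
have cW := (proj1 (no_subdivisionP tW)) nW.
exists W; split=> //; split=> [k V' eV'|k W' [eW' nW']].
  by have [tV' _ _] := one_extensions_props tV eV'; apply: one_completion_exists.
have [tW' sVW' cardW'] := one_extensions_props tV eW'.
have cW' := (proj1 (no_subdivisionP tW')) nW'; split.
  by apply/eqP; rewrite eqEsubset (one_extensions_sub tV eW' cW sVW)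
    (one_extensions_sub tV eW cW' sVW').
have /two_dimensionalP[_ _ /card_vc2] := tW'; rewrite cardW'; lia.
Qed.

(** * Projections on four coordinates *)

Section Monotone.

(* Conditionals instead of [&&] and [||] make these functions lazy under the
   call-by-value strategy of [vm_compute]. *)
Definition allb (P : bool -> bool) := if P true then P false else false.
Definition exb (P : bool -> bool) := if P true then true else P false.

(** At most one change of value along [a, b, c, d]: eight traces, forming an 8-cycle in the
    4-cube. *)
Definition mono4 (a b c d : bool) : bool :=
  if a == b then (if b == c then true else c == d)
  else (if b == c then c == d else false).

Implicit Type F : bool -> bool -> bool -> bool -> bool.

(* [F] stands for the trace on four coordinates of a fibre of the family. The
   traces [mono4] are those of the even cycle with these coordinates crossed in
   order. *)
Definition shatters_pair F :=
  if allb (fun a => allb (fun b => exb (fun c => exb (fun d => F a b c d))))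
  then true else
  if allb (fun a => allb (fun c => exb (fun b => exb (fun d => F a b c d))))
  then true else
  if allb (fun a => allb (fun d => exb (fun b => exb (fun c => F a b c d))))
  then true else
  if allb (fun b => allb (fun c => exb (fun a => exb (fun d => F a b c d))))
  then true else
  if allb (fun b => allb (fun d => exb (fun a => exb (fun c => F a b c d))))
  then true else
  allb (fun c => allb (fun d => exb (fun a => exb (fun b => F a b c d)))).

Definition has_nonmono F :=
  exb (fun a => exb (fun b => exb (fun c => exb (fun d =>
    if F a b c d then ~~ mono4 a b c d else false)))).

Definition mono_between F :=
  allb (fun a => allb (fun b => allb (fun c => allb (fun d =>
    if (if F a b c d then ~~ mono4 a b c d else false) then
      allb (fun a' => allb (fun b' => allb (fun c' => allb (fun d' =>
        if mono4 a' b' c' d' then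
          exb (fun x => exb (fun y => exb (fun z => exb (fun t =>
          if F x y z t then
            if mono4 x y z t then
              [&& (x == a) || (x == a'), (y == b) || (y == b'),
                  (z == c) || (z == c') & (t == d) || (t == d')]
            else false
          else false))))
        else true))))
    else true)))).

Definition connected4 F :=
  allb (fun a => allb (fun b => allb (fun c => allb (fun d =>
    if F a b c d then
      allb (fun a' => allb (fun b' => allb (fun c' => allb (fun d' =>
        if F a' b' c' d' then
          if (a == a') && (b == b') && (c == c') && (d == d') then true else
          [|| (a != a') && F (~~ a) b c d, (b != b') && F a (~~ b) c d,
              (c != c') && F a b (~~ c) d | (d != d') && F a b c (~~ d)]
        else true))))
    else true)))).

Definition mono4_obstruction F :=
  if has_nonmono F then
    if shatters_pair F then false else
    if mono_between F then connected4 F else false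
  else false.

Definition table4 b0 b1 b2 b3 b4 b5 b6 b7 b8 b9 b10 b11 b12 b13 b14 b15
    (a b c d : bool) : bool :=
  if a then
    if b then if c then if d then b0 else b1 else if d then b2 else b3
    else if c then if d then b4 else b5 else if d then b6 else b7
  else
    if b then if c then if d then b8 else b9 else if d then b10 else b11
    else if c then if d then b12 else b13 else if d then b14 else b15.

Lemma allbP P : allb P -> forall b, P b.
Proof. by rewrite /allb; case: ifP => // ? ? []. Qed.

(** Sixteen booleans encode a subset of the 4-cube, so this is a check of 2^16 cases. *)
Lemma table4_no_obstruction b0 b1 b2 b3 b4 b5 b6 b7 b8 b9 b10 b11 b12 b13 b14 b15 :
  ~~ mono4_obstruction
       (table4 b0 b1 b2 b3 b4 b5 b6 b7 b8 b9 b10 b11 b12 b13 b14 b15).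
Proof.
have : allb (fun b0 => allb (fun b1 => allb (fun b2 => allb (fun b3 =>
  allb (fun b4 => allb (fun b5 => allb (fun b6 => allb (fun b7 =>
  allb (fun b8 => allb (fun b9 => allb (fun b10 => allb (fun b11 =>
  allb (fun b12 => allb (fun b13 => allb (fun b14 => allb (fun b15 =>
  ~~ mono4_obstruction
   (table4 b0 b1 b2 b3 b4 b5 b6 b7 b8 b9 b10 b11 b12 b13 b14 b15))))))))))))))))).
  by vm_compute.
by move/allbP/(_ b0)/allbP/(_ b1)/allbP/(_ b2)/allbP/(_ b3)/allbP/(_ b4)
   /allbP/(_ b5)/allbP/(_ b6)/allbP/(_ b7)/allbP/(_ b8)/allbP/(_ b9)
   /allbP/(_ b10)/allbP/(_ b11)/allbP/(_ b12)/allbP/(_ b13)/allbP/(_ b14)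
   /allbP/(_ b15).
Qed.

Lemma no_mono4_obstruction F : ~~ mono4_obstruction F.
Proof.
(* [F] is evaluated only at explicit booleans, so the two obstructions are convertible and no
   extensionality is involved. *)
exact: (table4_no_obstruction
  (F true true true true) (F true true true false)
  (F true true false true) (F true true false false)
  (F true false true true) (F true false true false)
  (F true false false true) (F true false false false)
  (F false true true true) (F false true true false)
  (F false true false true) (F false true false false)
  (F false false true true) (F false false true false)
  (F false false false true) (F false false false false)).
Qed.

End Monotone.

(** * From the 4-cube to the whole family *)

Section Quadruples.

Variables (m : nat) (V : {set {set 'I_m}}) (x D : {set 'I_m}).
Variables (p q r s : 'I_m).
Implicit Types (A B C T : {set 'I_m}) (u w : 'I_m).

Definition mono_at T :=
  mono4 (p \in sep x T) (q \in sep x T) (r \in sep x T) (s \in sep x T).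

Hypotheses (sV : steps V) (v2 : vc2 V).
Hypothesis uniq_pqrs : [/\ p != q, p != r & p != s] /\ [/\ q != r, q != s & r != s].
Hypothesis D_pqrs : [/\ p \in D, q \in D, r \in D & s \in D].
Hypothesis in_mono : forall C, C \in V -> sep x C \subset D -> mono_at C.
Hypothesis mono_in : forall a b c d, mono4 a b c d ->
  exists C, [/\ C \in V, sep x C \subset D, (p \in sep x C) = a,
    (q \in sep x C) = b & (r \in sep x C) = c /\ (s \in sep x C) = d].

(* Take a non-monotone [T] closest to [x] outside [D], and the fibre of all
   members that agree with [T] outside [D]. A geodesic from a non-monotone vertex
   of the fibre to a member within [D] must become monotone before leaving the
   fibre, and the fibre shatters no pair of coordinates, since together with a
   coordinate outside [D] this would give a shattered triple. *)
Lemma mono_everywhere T : T \in V -> mono_at T.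
Proof.
move=> VT; apply/negPn/negP => nT.
pose bad T := (T \in V) && ~~ mono_at T.
have PT : bad T by rewrite /bad VT.
case: (arg_minnP (fun T => #|sep x T :\: D|) PT) => {nT PT VT}T.
move=> /andP[VT nT] minT; move eR : (sep x T :\: D) minT => R minT.
have [t Rt] : exists t, t \in R.
  apply/set0Pn; apply: contraNneq nT => R0; apply: in_mono => //.
  by rewrite -setD_eq0 eR R0.
have [tT tD] : t \in sep x T /\ t \notin D by move: Rt; rewrite -eR inE => /andP[].
have [Dp Dq Dr Ds] := D_pqrs.
have [[npq npr nps] [nqr nqs nrs]] := uniq_pqrs.
pose fib A := (A \in V) && (sep x A :\: D == R).
pose F a b c d := [exists A, [&& fib A, (p \in sep x A) == a,
  (q \in sep x A) == b, (r \in sep x A) == c & (s \in sep x A) == d]].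
have FP A : fib A -> F (p \in sep x A) (q \in sep x A) (r \in sep x A) (s \in sep x A).
  by move=> fA; apply/existsP; exists A; rewrite fA !eqxx.
have Fe a b c d : F a b c d -> exists A, [/\ fib A, (p \in sep x A) = a,
    (q \in sep x A) = b, (r \in sep x A) = c & (s \in sep x A) = d].
  by case/existsP=> A /and5P[fA /eqP pA /eqP qA /eqP rA /eqP sA]; exists A.
have fT : fib T by rewrite /fib VT eR eqxx.
have shat u w : u \in D -> w \in D -> u != w ->
    (forall a b, exists C, [/\ C \in V, sep x C \subset D,
       (u \in sep x C) = a & (w \in sep x C) = b]) ->
    ~ (forall a b, exists A, [/\ fib A, (u \in sep x A) = a & (w \in sep x A) = b]).
  move=> Du Dw nuw hC hA; apply: (v2 (x := x) (i := u) (j := w) (k := t)) => //.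
  - by apply: contraNneq tD => <-.
  - by apply: contraNneq tD => <-.
  move=> a b [].
    have [A [/andP[VA /eqP RA] uA wA]] := hA a b; exists A => //; split=> //.
    by move: Rt; rewrite -RA inE => /andP[].
  have [C [VC sC uC wC]] := hC a b; exists C => //; split=> //.
  by apply: contraNF tD; apply: (subsetP sC).
have := no_mono4_obstruction F; apply/negP; rewrite negbK /mono4_obstruction.
have -> : has_nonmono F.
  have exI (P : bool -> bool) b : P b -> exb P.
    by case: b => /= Pb; rewrite /exb Pb //; case: ifP.
  apply: (exI _ (p \in sep x T)); apply: (exI _ (q \in sep x T)).
  apply: (exI _ (r \in sep x T)); apply: (exI _ (s \in sep x T)).
  by rewrite (FP T fT).
have exE (P : bool -> bool) : exb P -> exists b, P b.
  by rewrite /exb; case: ifP => [?|_ ?]; [exists true | exists false].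
have allI (P : bool -> bool) : (forall b, P b) -> allb P by move=> H; rewrite /allb !H.
have pairP u w (P : bool -> bool -> bool) : u \in D -> w \in D -> u != w ->
    (forall a b, exists C, [/\ C \in V, sep x C \subset D,
       (u \in sep x C) = a & (w \in sep x C) = b]) ->
    (forall a b, P a b ->
       exists A, [/\ fib A, (u \in sep x A) = a & (w \in sep x A) = b]) ->
    allb (fun a => allb (P a)) = false.
  move=> Du Dw nuw hC hP; apply/negP=> /allbP all1.
  by apply: (shat u w Du Dw nuw hC) => a b; apply: hP; apply: (allbP (all1 a)).
have -> : shatters_pair F = false.
  (* Each pair takes all four values on the cycle: put the change of value between its two
     coordinates. *)
  rewrite /shatters_pair.
  rewrite (pairP p q) //; first last.
  - by move=> a b /exE[c /exE[d /Fe[A [? ? ? ? ?]]]]; exists A.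
  - move=> a b; have [|C [? ? ? ? [? ?]]] := @mono_in a b b b; last by exists C.
    by case: a b => [] [].
  rewrite (pairP p r) //; first last.
  - by move=> a b /exE[c /exE[d /Fe[A [? ? ? ? ?]]]]; exists A.
  - move=> a b; have [|C [? ? ? ? [? ?]]] := @mono_in a b b b; last by exists C.
    by case: a b => [] [].
  rewrite (pairP p s) //; first last.
  - by move=> a b /exE[c /exE[d /Fe[A [? ? ? ? ?]]]]; exists A.
  - move=> a b; have [|C [? ? ? ? [? ?]]] := @mono_in a b b b; last by exists C.
    by case: a b => [] [].
  rewrite (pairP q r) //; first last.
  - by move=> a b /exE[c /exE[d /Fe[A [? ? ? ? ?]]]]; exists A.
  - move=> a b; have [|C [? ? ? ? [? ?]]] := @mono_in a a b b; last by exists C.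
    by case: a b => [] [].
  rewrite (pairP q s) //; first last.
  - by move=> a b /exE[c /exE[d /Fe[A [? ? ? ? ?]]]]; exists A.
  - move=> a b; have [|C [? ? ? ? [? ?]]] := @mono_in a a b b; last by exists C.
    by case: a b => [] [].
  rewrite (pairP r s) //.
  - move=> a b; have [|C [? ? ? ? [? ?]]] := @mono_in a a a b; last by exists C.
    by case: a b => [] [].
  - by move=> a b /exE[c /exE[d /Fe[A [? ? ? ? ?]]]]; exists A.
have stepD A i : A \in V -> sep x A :\: D = R -> i \in D ->
    sep x (flip A i) :\: D = R.
  move=> VA RA Di; rewrite -RA; apply/setP=> j; rewrite !in_setD sep_flipr inE.
  by have [->|_] := eqVneq j i; rewrite ?Di ?addbF.
have -> : mono_between F.
  suff btw n A C : #|sep A C| <= n -> fib A -> ~~ mono_at A -> C \in V ->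
      sep x C \subset D -> exists K, [/\ fib K, mono_at K & sep A K \subset sep A C].
    do 4!(apply: (allI _) => ?); case: ifP => //.
    case: ifP => // /Fe[A [fA <- <- <- <-]] nA.
    do 4!(apply: (allI _) => ?); case: ifP => // /mono_in[C [VC sC <- <- [<- <-]]].
    have [K [fK mK sK]] := btw _ A C (leqnn _) fA nA VC sC.
    have bK u : ((u \in sep x K) == (u \in sep x A))
        || ((u \in sep x K) == (u \in sep x C)).
      have /implyP := subsetP sK u; rewrite !inE.
      by do 4!case: (_ \in _).
    have exI (P : bool -> bool) b : P b -> exb P.
      by case: b => /= Pb; rewrite /exb Pb //; case: ifP.
    apply: (exI _ (p \in sep x K)); apply: (exI _ (q \in sep x K)).
    apply: (exI _ (r \in sep x K)); apply: (exI _ (s \in sep x K)).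
    by rewrite (FP K fK) [mono4 _ _ _ _]mK !bK.
  elim: n A => [|n IH] A lenA fA nA VC sC.
    move: lenA; rewrite leqn0 cards_eq0 sep_eq0 => /eqP AC.
    by rewrite AC in_mono in nA.
  have /andP[VA /eqP RA] := fA.
  have nAC : A != C by apply: contraNneq nA => ->; apply: in_mono.
  have [i iAC Vi] := sV VA VC nAC.
  have [Di|nDi] := boolP (i \in D); last first.
    (* Crossing a coordinate outside [D] towards [C] removes it from [R] and keeps the trace,
       against the minimality of [T]. *)
    have Pi : bad (flip A i).
      rewrite /bad Vi; suff -> : mono_at (flip A i) = mono_at A by [].
      have e u : u \in D -> (u \in sep x (flip A i)) = (u \in sep x A).
        move=> Du; rewrite sep_flipr inE; case: eqP => [E|]; last by rewrite addbF.
        by rewrite -E Du in nDi.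
      by rewrite /mono_at !e.
    have := minT _ Pi; rewrite leqNgt => /negP[]; apply: proper_card.
    have nCi : i \notin sep x C by apply: contra nDi; apply: (subsetP sC).
    have Ai : i \in sep x A by move: iAC nCi; rewrite !inE; do 3!case: (_ \in _).
    apply/properP; split.
      apply/subsetP=> j; rewrite -RA !in_setD sep_flipr inE.
      by have [->|_] := eqVneq j i; rewrite ?Ai ?andbT ?addbF.
    exists i; first by rewrite -RA in_setD nDi Ai.
    by rewrite in_setD sep_flipr inE Ai eqxx andbF.
  have sE := sep_flipl iAC.
  have fi : fib (flip A i) by rewrite /fib Vi stepD ?eqxx.
  have sub B : sep (flip A i) B \subset sep (flip A i) C -> sep A B \subset sep A C.
    rewrite sE => /subsetP sB; apply/subsetP=> j jB.
    have [->//|nji] := eqVneq j i.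
    have : j \in sep (flip A i) B by move: jB; rewrite !inE (negPf nji) addbF.
    by move/sB; rewrite in_setD1 nji.
  have [mi|nmi] := boolP (mono_at (flip A i)).
    by exists (flip A i); split=> //; apply: sub; rewrite sepxx sub0set.
  have [|K [fK mK sK]] := IH (flip A i) _ fi nmi VC sC.
    by rewrite sE -ltnS; apply: leq_trans lenA; rewrite (cardsD1 i (sep A C)) iAC.
  by exists K; split=> //; apply: sub.
(* A geodesic in the fibre may first cross other coordinates of [D]. [K] is where it first crosses
   one of the four, so that the traces inherit the one-step form of isometry. *)
have conn n A B : #|sep A B| <= n -> fib A -> fib B ->
    ~~ all (fun u => (u \in sep x A) == (u \in sep x B)) [:: p; q; r; s] ->
    exists K u, [/\ fib K, fib (flip K u), u \in [:: p; q; r; s],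
      (u \in sep x A) != (u \in sep x B)
      & {in [:: p; q; r; s], forall w, (w \in sep x K) = (w \in sep x A)}].
  elim: n A => [|n IH] A lenA fA fB neq.
    move: lenA; rewrite leqn0 cards_eq0 sep_eq0 => /eqP AB.
    by move/negP: neq; case; rewrite AB; apply/allP.
  have /andP[VA /eqP RA] := fA; have /andP[VB /eqP RB] := fB.
  have nAB : A != B by apply: contraNneq neq => ->; apply/allP.
  have [i iAB Vi] := sV VA VB nAB.
  have Di : i \in D.
    apply: contraT => nDi; have := congr1 (fun X : {set 'I_m} => i \in X) RA.
    rewrite /= -RB !in_setD nDi /=; move: iAB; rewrite !inE.
    by do 3!case: (_ \in _).
  have fi : fib (flip A i) by rewrite /fib Vi stepD ?eqxx.
  have [ipq|ni] := boolP (i \in [:: p; q; r; s]).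
    exists A, i; split=> //; move: iAB; rewrite !inE.
    by do 3!case: (_ \in _).
  have e u : u \in [:: p; q; r; s] -> (u \in sep x (flip A i)) = (u \in sep x A).
    move=> Hu; rewrite sep_flipr inE; case: eqP => [E|]; last by rewrite addbF.
    by rewrite -E Hu in ni.
  have [||K [u [? ? Hu]]] := IH (flip A i) _ fi fB.
  - rewrite sep_flipl // -ltnS; apply: leq_trans lenA.
    by rewrite (cardsD1 i (sep A B)) iAB.
  - by apply: contra neq => /allP al; apply/allP=> u Hu; rewrite -e // al.
  rewrite e // => ? ee; exists K, u; split=> // w Hw; by rewrite ee // e.
do 4!(apply: (allI _) => ?); case: ifP => // /Fe[A [fA <- <- <- <-]].
do 4!(apply: (allI _) => ?); case: ifP => // /Fe[B [fB <- <- <- <-]].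
case: ifP => // neq.
have [|K [u [fK fKu Hu nu eK]]] := conn _ A B (leqnn _) fA fB.
  by rewrite /= andbT; move/negbT: neq; rewrite -!andbA.
have [eKp eKq eKr eKs] : [/\ (p \in sep x K) = (p \in sep x A),
  (q \in sep x K) = (q \in sep x A), (r \in sep x K) = (r \in sep x A)
  & (s \in sep x K) = (s \in sep x A)].
  by split; apply: eK; rewrite !inE eqxx ?orbT.
have val w : (w \in sep x (flip K u)) = (w \in sep x K) (+) (w == u).
  by rewrite sep_flipr inE.
have S := (eq_sym q p, eq_sym r p, eq_sym s p, eq_sym r q, eq_sym s q, eq_sym s r).
have N := (negPf npq, negPf npr, negPf nps, negPf nqr, negPf nqs, negPf nrs).
have := FP _ fKu; rewrite !val eKp eKq eKr eKs; move: Hu nu.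
rewrite 3!in_cons mem_seq1 => /or4P[]/eqP->; rewrite eqxx ?S ?N !addbF addbT => -> ->.
all: by rewrite ?orbT.
Qed.

End Quadruples.

(** * Consecutive edges of a zone *)

Section Zones.

Variables (m : nat) (V : {set {set 'I_m}}).
Implicit Types (A B C T b c x y z : {set 'I_m}) (g i j k : 'I_m).
Hypotheses (sV : steps V) (v2 : vc2 V) (no_apex : forall v, ~~ apex V v).

Lemma between_sep x A B C i : sep A C \subset sep A B ->
  (i \in sep x A) = (i \in sep x B) -> (i \in sep x C) = (i \in sep x A).
Proof. by move=> sC; apply: between_eq; rewrite !sep_sep. Qed.

Definition consecutive x y g :=
  [/\ [/\ x \in V, y \in V, flip x g \in V & flip y g \in V],
      g \notin sep x y
    & forall z, z \in V -> flip z g \in V -> sep x z \subset sep x y ->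
        z = x \/ z = y].

Lemma sep_flip2 A B g : sep (flip A g) (flip B g) = sep A B.
Proof.
by apply/setP=> i; rewrite !inE; do 2!case: (_ \in _); case: (_ == _).
Qed.

Lemma consecutive_flip x y g :
  consecutive x y g -> consecutive (flip x g) (flip y g) g.
Proof.
case=> [[Vx Vy Vx' Vy'] gxy cons]; split; rewrite ?sep_flip2 ?flipK //.
move=> z Vz Vz' sz; have [|||<-|<-] := cons (flip z g); rewrite ?flipK //.
- by move: sz; rewrite ?sep_flip2 -(sep_flip2 x (flip z g) g) flipK.
- by left.
- by right.
Qed.

(** * The cycle spanned by two consecutive edges *)

Section Consecutive.

Variables (x y : {set 'I_m}) (g : 'I_m).
Hypothesis cons : consecutive x y g.
Let E := sep x y.
Let D := g |: E.

(** If neither had crossed [j], a geodesic from [c] to [b] would keep [i] and avoid [j], and so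
    cross [g] strictly between [x] and [y]. Hence the far side, read from [flip x g], crosses the
    coordinates in the reverse of the near order. *)
Lemma opposite_sides b c i j : b \in V -> c \in V ->
  sep x b \subset D -> sep x c \subset D ->
  g \in sep x b -> g \notin sep x c -> i \in E -> j \in E ->
  i \in sep x b -> i \in sep x c -> j \in sep x b \/ j \in sep x c.
Proof.
move=> Vb Vc sb sc gb gc Ei Ej ib ic.
have [jb|njb] := boolP (j \in sep x b); first by left.
have [jc|njc] := boolP (j \in sep x c); first by right.
have gbc : g \in sep c b by rewrite -(sep_sep x) inE gb (negPf gc).
have [C [VC VCg sC gC]] := steps_edge sV Vc Vb gbc.
have [_ gE uniq] := cons.
have iC : i \in sep x C by rewrite (between_sep sC) ic ?ib.
have jC : j \notin sep x C by rewrite (between_sep sC) (negPf njc) ?(negPf njb).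
have [] := uniq C VC VCg.
- apply/subsetP=> k kC.
  have [kc|nkc] := boolP (k \in sep x c).
    have := subsetP sc k kc; rewrite in_setU1; case: eqP => // E'.
    by rewrite -E' kc in gc.
  have kb : k \in sep x b.
    by apply: contraTT kC => nkb; rewrite (between_sep sC) (negPf nkc) ?(negPf nkb).
  have := subsetP sb k kb; rewrite in_setU1; case: eqP => // E'.
  subst k; have : g \in sep c C by rewrite -(sep_sep x) inE (negPf nkc) kC.
  by rewrite (negPf gC).
- by move=> EC; rewrite EC sepxx inE in iC.
- by move=> EC; move: jC; rewrite EC Ej.
Qed.

Lemma split_near i j : i != j -> i \in E -> j \in E ->
  exists c, [/\ c \in V, sep x c \subset E & (i \in sep x c) != (j \in sep x c)].
Proof.
case: cons => [[Vx Vy _ _] _ _] nij Ei Ej; exact: steps_split sV Vx Vy nij Ei Ej.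
Qed.

Lemma split_far i j : i != j -> i \in E -> j \in E ->
  exists c, [/\ c \in V, sep x c \subset D, g \in sep x c
              & (i \in sep x c) != (j \in sep x c)].
Proof.
case: cons => [[_ _ Vx Vy] gE _] nij Ei Ej.
have [||c [Vc sc ijc]] := steps_split sV Vx Vy nij; rewrite ?sep_flip2 //.
rewrite sep_flip2 -/E in sc.
have e k : (k \in sep x c) = (k \in sep (flip x g) c) (+) (k == g).
  by rewrite !inE; do 2!case: (_ \in _); case: (_ == _).
have gc : g \notin sep (flip x g) c by apply: contra gE; apply: (subsetP sc).
have ne k : k \in E -> (k == g) = false.
  by move=> Ek; apply: contraNF gE => /eqP<-.
exists c; split=> //.
- apply/subsetP=> k; rewrite e in_setU1; case: eqP => //= _.
  by rewrite addbF; apply: (subsetP sc).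
- by rewrite e eqxx (negPf gc).
- by rewrite !e !ne // !addbF.
Qed.

(* Order in which the geodesic from [x] to [y] in [V] crosses the coordinates. *)
Definition before i j :=
  exists c, [/\ c \in V, sep x c \subset E, i \in sep x c & j \notin sep x c].

Lemma near_notin c : sep x c \subset E -> g \notin sep x c.
Proof. by case: cons => _ gE _ sc; apply: contra gE; apply: (subsetP sc). Qed.

Lemma near_sub c : sep x c \subset E -> sep x c \subset D.
Proof. by move/subset_trans; apply; apply: subsetUr. Qed.

Lemma sub_near c : sep x c \subset D -> g \notin sep x c -> sep x c \subset E.
Proof.
move=> sc gc; apply/subsetP=> k kc; have := subsetP sc k kc.
by rewrite in_setU1; case: eqP => // Ek; rewrite -Ek kc in gc.
Qed.

Lemma before_total i j : i != j -> i \in E -> j \in E -> before i j \/ before j i.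
Proof.
move=> nij Ei Ej; have [c [Vc sc]] := split_near nij Ei Ej.
have [ic|nic] := boolP (i \in sep x c); have [jc|njc] := boolP (j \in sep x c) => // _.
  by left; exists c.
by right; exists c.
Qed.

Lemma before_far i j c : i \in E -> j \in E -> before i j -> c \in V ->
  sep x c \subset D -> g \in sep x c -> i \in sep x c -> j \in sep x c.
Proof.
move=> Ei Ej [a [Va sa ia ja]] Vc sc gc ic.
have [//|] := opposite_sides Vc Va sc (near_sub sa) gc (near_notin sa) Ei Ej ic ia.
by rewrite (negPf ja).
Qed.

Lemma before_far_ex i j : i != j -> i \in E -> j \in E -> before i j ->
  exists c, [/\ c \in V, sep x c \subset D, g \in sep x c, i \notin sep x c
              & j \in sep x c].
Proof.
move=> nij Ei Ej bij; have [c [Vc sc gc ijc]] := split_far nij Ei Ej.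
have bf := before_far Ei Ej bij Vc sc gc; exists c.
by move: ijc bf; case: (i \in _); case: (j \in _) => // _ /(_ isT).
Qed.

Lemma before_near i j c : i != j -> i \in E -> j \in E -> before i j ->
  c \in V -> sep x c \subset E -> j \in sep x c -> i \in sep x c.
Proof.
move=> nij Ei Ej bij Vc sc jc.
have [b [Vb sb gb ib jb]] := before_far_ex nij Ei Ej bij.
have [|//] := opposite_sides Vb Vc sb (near_sub sc) gb (near_notin sc) Ej Ei jb jc.
by rewrite (negPf ib).
Qed.

(** Starting at [x], the cycle crosses [i, j, k, g] and then [i, j, k, g] again, which is why [g]
    comes last in [mono4]. *)
Lemma mono_sorted i j k T : i != j -> i != k -> j != k ->
  i \in E -> j \in E -> k \in E -> before i j -> before j k -> T \in V ->
  mono4 (i \in sep x T) (j \in sep x T) (k \in sep x T) (g \in sep x T).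
Proof.
move=> nij nik njk Ei Ej Ek bij bjk.
have [[Vx Vy Vx' Vy'] gE _] := cons.
have ng l : l \in E -> l != g by apply: contraTneq => ->.
have sepxg : sep x (flip x g) = [set g] by apply: sep_flip.
have sepyg : sep x (flip y g) = D.
  apply/setP=> l; rewrite sep_flipr inE in_setU1 -/E.
  by have [->|_] := eqVneq l g; rewrite ?(negPf gE) ?addbF.
apply: (@mono_everywhere m V x D) => //.
- by rewrite nij nik njk !ng.
- by rewrite /D !in_setU1 eqxx Ei Ej Ek !orbT.
- move=> C VC sC; rewrite /mono_at.
  have [gC|ngC] := boolP (g \in sep x C).
    have /implyP := before_far Ei Ej bij VC sC gC.
    by have /implyP := before_far Ej Ek bjk VC sC gC; do 3!case: (_ \in _).
  have sC' := sub_near sC ngC.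
  have /implyP := before_near nij Ei Ej bij VC sC'.
  by have /implyP := before_near njk Ej Ek bjk VC sC'; do 3!case: (_ \in _).
have nE := negPf gE.
case=> [] [] [] [] // _.
- exists (flip y g); rewrite sepyg subxx /D !in_setU1 eqxx Ei Ej Ek !orbT; by [].
- by exists y; rewrite near_sub ?subxx // -/E Ei Ej Ek nE.
- have [c [Vc sc jc kc]] := bjk; exists c.
  rewrite near_sub // (before_near nij Ei Ej bij Vc sc jc) jc.
  by rewrite (negPf kc) (negPf (near_notin sc)).
- have [c [Vc sc ic jc]] := bij; exists c.
  rewrite near_sub // ic (negPf jc) (negPf (near_notin sc)); split=> //; split=> //.
  by apply: contraNF jc; apply: before_near.
- have [c [Vc sc gc ic jc]] := before_far_ex nij Ei Ej bij; exists c.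
  by rewrite sc (negPf ic) jc gc (before_far Ej Ek bjk Vc sc gc jc).
- have [c [Vc sc gc jc kc]] := before_far_ex njk Ej Ek bjk; exists c.
  rewrite sc (negPf jc) kc gc; split=> //.
  by apply: contraNF jc; apply: before_far.
- exists (flip x g); rewrite sepxg sub1set setU11 !in_set1.
  by rewrite (negPf (ng _ Ei)) (negPf (ng _ Ej)) (negPf (ng _ Ek)) eqxx.
- by exists x; rewrite sepxx sub0set !inE.
Qed.

(** Extends [opposite_sides] to a [T] that may differ from [x] outside [D]. A counterexample forces
    [j] before [i], and [T] then reads 0, 1, 0 at [j, i, g]: two changes, which [mono_sorted]
    forbids as soon as [E] has a third coordinate. *)
Lemma opposite_sides_near T b i j : T \in V -> b \in V -> sep x b \subset D ->
  g \notin sep x T -> g \in sep x b -> i \in E -> j \in E ->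
  i \in sep x T -> i \in sep x b -> j \in sep x T \/ j \in sep x b.
Proof.
move=> VT Vb sb gT gb Ei Ej iT ib.
have [jT|njT] := boolP (j \in sep x T); first by left.
have [jb|njb] := boolP (j \in sep x b); first by right.
have nij : i != j by apply: contraNneq njT => <-.
have bji : before j i.
  have [bij|//] := before_total nij Ei Ej.
  by rewrite (before_far Ei Ej bij Vb sb gb ib) in njb.
have [[Vx Vy Vx' Vy'] gE _] := cons.
have ng l : l \in E -> l != g by apply: contraTneq => ->.
have [/existsP[k /and3P[Ek nki nkj]]|/existsPn no] :=
  boolP [exists k, [&& k \in E, k != i & k != j]].
  exfalso; have njk : j != k by rewrite eq_sym.
  have nik : i != k by rewrite eq_sym.
  have nji : j != i by rewrite eq_sym.
  have [bjk|bkj] := before_total njk Ej Ek.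
    have [bik|bki] := before_total nik Ei Ek.
      have := mono_sorted nji njk nik Ej Ei Ek bji bik VT.
      by rewrite (negPf gT) iT (negPf njT); case: (_ \in _).
    have := mono_sorted njk nji nki Ej Ek Ei bjk bki VT.
    by rewrite (negPf gT) iT (negPf njT); case: (_ \in _).
  have := mono_sorted nkj nki nji Ek Ej Ei bkj bji VT.
  by rewrite (negPf gT) iT (negPf njT); case: (_ \in _).
(* Now [E] is [{i, j}], and [v] is the corner of the 3-cube to which [T] projects. Its neighbours
   [x], [y] and [b] are in [V], and [nbr_toward] yields a fourth in a direction that separates [v]
   from [T]. *)
exfalso; pose v := flip b g.
have EP k : k \in E -> k = i \/ k = j.
  move=> Ek; have := no k; rewrite Ek /= negb_and !negbK.
  by case/orP => /eqP; [left | right].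
have vE k : (k \in sep x v) = (k == i).
  rewrite sep_flipr inE; have [->|nkg] := eqVneq k g.
    by rewrite gb eq_sym (negPf (ng _ Ei)).
  rewrite addbF; have [kb|nkb] := boolP (k \in sep x b).
    have := subsetP sb k kb; rewrite in_setU1 (negPf nkg) /= => /EP[->|Ek].
      by rewrite eqxx.
    by rewrite Ek (negPf njb) in kb.
  by apply/esym/negbTE; apply: contraNneq nkb => ->.
have Vv : v \notin V.
  apply/negP=> Vv; have := opposite_sides Vb Vv sb _ gb _ Ei Ej ib.
  rewrite !vE eqxx (negPf njb) [j == i]eq_sym (negPf nij).
  rewrite [g == i]eq_sym (negPf (ng _ Ei)).
  case=> //; apply/subsetP=> k; rewrite vE => /eqP->.
  by rewrite in_setU1 Ei orbT.
have Ni : i \in nbr V v.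
  rewrite inE; suff -> : flip v i = x by [].
  apply/eqP; rewrite -sep_eq0 sepC; apply/eqP/setP=> k.
  by rewrite in_set0 sep_flipr [LHS]inE vE addbb.
have Nj : j \in nbr V v.
  rewrite inE; suff -> : flip v j = y by [].
  apply/eqP; rewrite -sep_eq0 -(sep_sep x); apply/eqP/setP=> k.
  rewrite in_set0 [LHS]inE -/E.
  have -> : (k \in sep x (flip v j)) = (k == i) (+) (k == j).
    by rewrite sep_flipr [LHS]inE vE.
  have [Ek|nEk] := boolP (k \in E).
    by have [->|->] := EP k Ek; rewrite eqxx ?(negPf nij) // eq_sym (negPf nij).
  rewrite addbF; have [Ek|_] := eqVneq k i; first by rewrite -Ek (negPf nEk) in Ei.
  by have [Ek|_] := eqVneq k j; first by rewrite -Ek (negPf nEk) in Ej.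
have Ng : g \in nbr V v by rewrite inE flipK.
have nT k : (k \in sep x T) = (k == i) -> k \notin sep v T.
  by rewrite -vE => e; rewrite -(sep_sep x) inE e addbb.
have [niT njT' ngT] : [/\ i \notin sep v T, j \notin sep v T & g \notin sep v T].
  split; apply: nT.
  - by rewrite iT eqxx.
  - by rewrite (negPf njT) eq_sym (negPf nij).
  - by rewrite (negPf gT) eq_sym (negPf (ng _ Ei)).
have [r rT Nr] := nbr_toward sV v2 Vv nij (ng i Ei) (ng j Ej) Ni Nj Ng VT niT njT' ngT.
have nr k : k \notin sep v T -> k != r by apply: contraNneq => ->.
have := no_apex v; rewrite /apex Vv /= => /negP[].
have sub : r |: (g |: [set i; j]) \subset nbr V v.
  by rewrite !subUset !sub1set Nr Ng Ni Nj.
apply: leq_trans (subset_leq_card sub).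
rewrite !cardsU1 cards1 !inE nij !negb_or ![g == _]eq_sym (ng _ Ei) (ng _ Ej).
by rewrite ![r == _]eq_sym !nr.
Qed.

(** Take [b] on the far side agreeing with [T] on as few coordinates of [E] as possible. If they
    agree at [i], step from [b] towards the end, [flip x g] or [flip y g], that differs from [b] at
    [i]. The coordinate [a] crossed either lowers the agreement or, together with [i], contradicts
    [opposite_sides_near]. *)
Lemma antipode_near T : T \in V -> g \notin sep x T ->
  exists A, [/\ A \in V, sep x A \subset D & D \subset sep A T].
Proof.
move=> VT gT; have [[Vx Vy Vx' Vy'] gE _] := cons.
pose P b := [&& b \in V, sep x b \subset D & g \in sep x b].
have P0 : P (flip x g).
  by rewrite /P Vx' sep_flip sub1set setU11 set11.
case: (arg_minnP (fun b => #|E :\: sep b T|) P0) => b /and3P[Vb sb gb] min.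
have [E0|/set0Pn[i]] := eqVneq (E :\: sep b T) set0.
  exists b; split=> //; rewrite subUset sub1set -setD_eq0 E0 eqxx andbT.
  by rewrite -(sep_sep x) inE gb (negPf gT).
rewrite inE => /andP[iT Ei].
have agr k : k \notin sep b T -> (k \in sep x T) = (k \in sep x b).
  by rewrite -(sep_sep x) [in X in X -> _]inE; do 2!case: (_ \in _).
have ng k : k \in E -> k != g by apply: contraTneq => ->.
have eb a : a \in E -> sep x (flip b a) \subset D /\ g \in sep x (flip b a).
  move=> Ea; split.
    apply/subsetP=> k; rewrite sep_flipr inE; case: eqP => [->|_].
      by rewrite in_setU1 Ea orbT.
    by rewrite addbF; apply: (subsetP sb).
  by rewrite sep_flipr inE [g == a]eq_sym (negPf (ng _ Ea)) addbF.
have better a : a \in E -> a \notin sep b T -> flip b a \notin V.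
  move=> Ea aT; apply/negP=> Vba.
  have [sba gba] := eb a Ea.
  have Pa : P (flip b a) by rewrite /P Vba sba gba.
  have := min _ Pa; rewrite leqNgt => /negP[]; apply: proper_card.
  have e k : (k \in sep (flip b a) T) = (k \in sep b T) (+) (k == a).
    by rewrite !inE; do 2!case: (_ \in _); case: (_ == _).
  apply/properP; split.
    apply/subsetP=> k; rewrite !in_setD e; have [->|_] := eqVneq k a; rewrite ?addbF //.
    by rewrite (negPf aT).
  by exists a; rewrite in_setD ?e ?Ea ?aT // (negPf aT) eqxx.
exfalso; have [ib|nib] := boolP (i \in sep x b).
  have nbx : b != flip x g.
    by apply: contraTneq ib => ->; rewrite sep_flip inE ng.
  have [a abx Vba] := sV Vb Vx' nbx.
  have [nag ab] : a != g /\ a \in sep x b.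
    move: abx; rewrite -(sep_sep x) sep_flip inE [a \in [set g]]inE.
    by case: eqP => [->|_]; rewrite ?gb // addbF.
  have Ea : a \in E by have := subsetP sb a ab; rewrite in_setU1 (negPf nag).
  have [aT|naT] := boolP (a \in sep b T); last first.
    by rewrite (negPf (better a Ea naT)) in Vba.
  have nia : i != a by apply: contraNneq iT => ->.
  have [sba gba] := eb a Ea.
  have [] := @opposite_sides_near T (flip b a) i a VT Vba sba gT gba Ei Ea.
  - by rewrite agr.
  - by rewrite sep_flipr inE (negPf nia) addbF.
  - by move: aT; rewrite -(sep_sep x) inE ab; case: (_ \in _).
  - by rewrite sep_flipr inE eqxx ab.
have nby : b != flip y g.
  by apply: contraNneq nib => ->; rewrite sep_flipr inE -/E Ei (negPf (ng _ Ei)).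
have [a aby Vba] := sV Vb Vy' nby.
have [Ea ab] : a \in E /\ a \notin sep x b.
  move: aby; rewrite -(sep_sep x) inE sep_flipr [a \in [set j | _]]inE -/E.
  have [->|nag] := eqVneq a g; first by rewrite gb (negPf gE).
  rewrite addbF; have [ab|] := boolP (a \in sep x b); last by [].
  by have := subsetP sb a ab; rewrite in_setU1 (negPf nag) /= => ->.
have [aT|naT] := boolP (a \in sep b T); last first.
    by rewrite (negPf (better a Ea naT)) in Vba.
have nia : i != a by apply: contraNneq iT => ->.
have [sba gba] := eb a Ea.
have [] := @opposite_sides_near T (flip b a) a i VT Vba sba gT gba Ea Ei.
- by move: aT; rewrite -(sep_sep x) inE (negPf ab).
- by rewrite sep_flipr inE eqxx (negPf ab).
- by rewrite agr // (negPf nib).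
- by rewrite sep_flipr inE (negPf nia) addbF (negPf nib).
Qed.

End Consecutive.

(** This is the hypothesis of [zero_on_covector] for the cycle. A [T] on the far side becomes near
    after exchanging the two ends of both edges. *)
Lemma antipode x y g T : consecutive x y g -> T \in V ->
  exists A, [/\ A \in V, sep x A \subset g |: sep x y
              & g |: sep x y \subset sep A T].
Proof.
move=> cons VT; have [gT|gT] := boolP (g \in sep x T); last exact: antipode_near.
have [|A [VA sA AT]] := antipode_near (consecutive_flip cons) VT.
  by move: gT; rewrite !inE eqxx; do 2!case: (_ \in _).
rewrite sep_flip2 in sA AT; exists A; split=> //.
apply/subsetP=> k kA; rewrite in_setU1; case: eqP => //= nkg.
have : k \in sep (flip x g) A by move: kA; rewrite !inE; case: eqP => // _; rewrite addbF.
by move/(subsetP sA); rewrite in_setU1; case: eqP.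
Qed.

(** Choose two edges in direction [g] that [e] separates, at minimal distance. A third one between
    them would be separated by [e] from one of the two, and is closer to it. *)
Lemma consecutive_between x y g e : x \in V -> y \in V -> flip x g \in V ->
  flip y g \in V -> g \notin sep x y -> e \in sep x y ->
  exists z w, [/\ consecutive z w g, e \in sep z w, sep z w \subset sep x y
                & sep x z \subset sep x y].
Proof.
move=> Vx Vy Vx' Vy' gxy exy.
pose ok z := [&& z \in V, flip z g \in V & sep x z \subset sep x y].
pose P (u : {set 'I_m} * {set 'I_m}) := [&& ok u.1, ok u.2 & e \in sep u.1 u.2].
have P0 : P (x, y).
  by rewrite /P /ok /= Vx Vy Vx' Vy' exy subxx sepxx sub0set.
case: (arg_minnP (fun u : {set 'I_m} * {set 'I_m} => #|sep u.1 u.2|) P0).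
move=> [z w] /= /and3P[okz okw ezw] min.
have sub a b : ok a -> ok b -> sep a b \subset sep x y.
  case/and3P=> _ _ /subsetP sa /and3P[_ _ /subsetP sb]; apply/subsetP=> k.
  rewrite -(sep_sep x) inE; have [/sa//|nka] := boolP (k \in sep x a).
  exact: sb.
exists z, w; split=> //; last 2 first.
- exact: sub.
- by case/and3P: okz.
have [Vz Vz' sz] := and3P okz; have [Vw Vw' sw] := and3P okw.
split=> //; first by apply: contra gxy; apply: (subsetP (sub _ _ okz okw)).
move=> u Vu Vu' su.
have oku : ok u.
  rewrite /ok Vu Vu'; apply/subsetP=> k; rewrite -[sep x u](sep_sep z) inE.
  have [kz|nkz] := boolP (k \in sep z x).
    by move=> _; apply: (subsetP sz); rewrite sepC.
  by move/(subsetP su)/(subsetP (sub _ _ okz okw)).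
have [->|nuz] := eqVneq u z; first by left.
have [->|nuw] := eqVneq u w; first by right.
have suw : sep u w \subset sep z w.
  apply/subsetP=> k; have /implyP := subsetP su k; rewrite !inE.
  by do 3!case: (_ \in _).
have lt1 : sep z u \proper sep z w.
  rewrite properEneq su andbT; apply: contra nuw => /eqP/(congr1 (sep z)).
  by rewrite !sepK => ->.
have lt2 : sep u w \proper sep z w.
  rewrite properEneq suw andbT; apply: contra nuz.
  by rewrite ![sep _ w]sepC => /eqP/(congr1 (sep w)); rewrite !sepK => ->.
have [eu|neu] := boolP (e \in sep z u).
  have Pu : P (z, u) by rewrite /P /= okz oku.
  by have := min _ Pu; rewrite leqNgt (proper_card lt1).
have eu : e \in sep u w by move: ezw neu; rewrite !inE; do 3!case: (_ \in _).
have Pu : P (u, w) by rewrite /P /= oku okw.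
by have := min _ Pu; rewrite leqNgt (proper_card lt2).
Qed.

End Zones.

Import GRing.Theory.

(** * Covectors *)

Section SignVectors.

Local Open Scope ring_scope.

Definition sgn (b : bool) : 'F_3 := if b then 1 else -1.

Lemma sgn_neq0 b : sgn b != 0. Proof. by case: b. Qed.

Lemma sgnN b : - sgn b = sgn (~~ b).
Proof. by case: b => //=; rewrite opprK. Qed.

Lemma sgn_inj : injective sgn. Proof. by case=> [] []. Qed.

Lemma F3P (z : 'F_3) : z = 0 \/ exists b, z = sgn b.
Proof.
case: z => [[|[|[|//]]] lt3]; first by left; apply: val_inj.
  by right; exists true; apply: val_inj.
by right; exists false; apply: val_inj.
Qed.

Variables (m : nat) (V : {set {set 'I_m}}).
Implicit Types (A B C D T x y : {set 'I_m}) (i : 'I_m).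

(** Coordinates that are constant on [V] have to be dropped: a simple system takes all three signs
    at each element. *)
Definition crossed i := [exists A in V, [exists B in V, i \in sep A B]].

Lemma crossedP A B i : A \in V -> B \in V -> i \in sep A B -> crossed i.
Proof.
by move=> VA VB iAB; apply/exists_inP; exists A => //; apply/exists_inP; exists B.
Qed.

Local Notation U := {i : 'I_m | crossed i}.
Implicit Types (X Y Z : {ffun U -> 'F_3}) (u e : U).

Definition sign_vector A : {ffun U -> 'F_3} := [ffun u => sgn (val u \in A)].

Definition zero_on (D : {set 'I_m}) A : {ffun U -> 'F_3} :=
  [ffun u => if val u \in D then 0 else sgn (val u \in A)].

Definition covectors : {set {ffun U -> 'F_3}} :=
  [set X | [forall T in V, composition X (- sign_vector T) \in sign_vector @: V]].

Lemma sign_vector_inj : {in V &, injective sign_vector}.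
Proof.
move=> A B VA VB /ffunP E; apply/setP=> i; apply/eqP; apply: contraT => neq.
have iAB : i \in sep A B by rewrite inE; move: neq; do 2!case: (_ \in _).
have := E (exist _ i (crossedP VA VB iAB)); rewrite !ffunE /= => /sgn_inj E'.
by rewrite E' eqxx in neq.
Qed.

Lemma covectorsP X : reflect
  (forall T, T \in V -> exists2 A, A \in V &
     forall u, sgn (val u \in A) = if X u != 0 then X u else sgn (val u \notin T))
  (X \in covectors).
Proof.
rewrite inE; apply: (iffP forall_inP) => H T VT.
  have /imsetP[A VA /ffunP E] := H T VT; exists A => // u.
  by have := E u; rewrite !ffunE sgnN => ->.
have [A VA E] := H T VT; apply/imsetP; exists A => //; apply/ffunP=> u.
by rewrite !ffunE sgnN E.
Qed.

(** Apply the defining property twice: [X o -(X o (-T))] is [X o T]. *)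
Lemma covectors_comp X T : X \in covectors -> T \in V ->
  exists2 A, A \in V &
    forall u, sgn (val u \in A) = if X u != 0 then X u else sgn (val u \in T).
Proof.
move=> /covectorsP LX VT; have [B VB EB] := LX T VT; have [A VA EA] := LX B VB.
exists A => // u; rewrite EA; case: ifP => // X0; congr sgn.
by have := EB u; rewrite X0 => /sgn_inj->; rewrite negbK.
Qed.

Lemma sign_vector_covector A : A \in V -> sign_vector A \in covectors.
Proof.
by move=> VA; apply/covectorsP=> T VT; exists A => // u; rewrite !ffunE sgn_neq0.
Qed.

(** [B] is the tope [zero_on D A o (-T)]: equal to [A] outside [D] and opposite to [T] on [D]. *)
Lemma zero_on_covector D A : A \in V ->
  (forall T, T \in V ->
     exists B, [/\ B \in V, sep A B \subset D & D \subset sep B T]) ->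
  zero_on D A \in covectors.
Proof.
move=> VA H; apply/covectorsP=> T VT; have [B [VB AB BT]] := H T VT.
exists B => // u; rewrite ffunE; case: (boolP (val u \in D)) => [Du|nDu].
  rewrite eqxx /=; congr sgn; have := subsetP BT _ Du; rewrite inE.
  by do 2!case: (_ \in _).
rewrite sgn_neq0; congr sgn; have /implyP := subsetP AB (val u).
by rewrite (negPf nDu) inE; do 2!case: (_ \in _).
Qed.

Lemma edge_covector A i : A \in V -> flip A i \in V -> zero_on [set i] A \in covectors.
Proof.
move=> VA VAi; apply: zero_on_covector => // T VT.
have [iAT|niAT] := boolP (i \in sep A T).
  by exists A; rewrite sepxx sub0set sub1set.
exists (flip A i); rewrite VAi sep_flip subxx sub1set; split=> //.
by move: niAT; rewrite !inE eqxx; do 2!case: (_ \in _).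
Qed.

Lemma topes_covectors : V != set0 -> topes covectors = sign_vector @: V.
Proof.
case/set0Pn=> T VT; apply/setP=> X; rewrite inE; apply/andP/imsetP.
  move=> [LX /forall_inP max]; have [A VA E] := covectors_comp LX VT.
  exists A => //; apply/esym/eqP/(implyP (max _ (sign_vector_covector VA))).
  apply/forallP=> u; rewrite ffunE E; by case: (X u == 0) => //=.
move=> [A VA ->]; split; first exact: sign_vector_covector.
apply/forall_inP=> Y _; apply/implyP=> /forallP le; apply/eqP/ffunP=> u.
by have := le u; rewrite ffunE (negPf (sgn_neq0 _)) => /eqP.
Qed.

Lemma sign_vector_iso : V != set0 ->
  graph_iso (@cube_adj m) V (@tope_adj U) (topes covectors) sign_vector.
Proof.
move=> V0; split; [exact: sign_vector_inj | by rewrite topes_covectors |].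
move=> A B VA VB; rewrite cube_adjE /tope_adj.
have -> : sep A B = [set val u | u in [set u | sign_vector A u != sign_vector B u]].
  apply/setP=> i; apply/idP/imsetP=> [iAB|[u]].
    exists (exist _ i (crossedP VA VB iAB)) => //.
    rewrite inE !ffunE (inj_eq sgn_inj) /=; move: iAB; rewrite inE.
    by do 2!case: (_ \in _).
  rewrite inE !ffunE (inj_eq sgn_inj) => neq ->; rewrite inE.
  by move: neq; do 2!case: (_ \in _).
by rewrite card_imset //; apply: val_inj.
Qed.

Lemma crossed_edge u : steps V -> exists2 A, A \in V & flip A (val u) \in V.
Proof.
move=> sV; have /exists_inP[A VA /exists_inP[B VB uAB]] := valP u.
by have [C [VC VCu _ _]] := steps_edge sV VA VB uAB; exists C.
Qed.

Lemma simple_covectors : steps V -> simple_system covectors.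
Proof.
move=> sV; split=> [u|u w nuw]; have [A VA VAu] := crossed_edge u sV.
  have uAu : (val u \in flip A (val u)) = (val u \notin A) by rewrite inE eqxx addbT.
  apply/setP=> z; apply/imsetP/idP => [[X _ ->]|].
    by rewrite !inE; have [->|[[] ->]] := F3P (X u); rewrite ?eqxx ?orbT.
  have [->|[b ->]] := F3P z => _.
    by exists (zero_on [set val u] A); rewrite ?edge_covector // ffunE set11.
  have [e|ne] := eqVneq (val u \in A) b.
    by exists (sign_vector A); rewrite ?sign_vector_covector // ffunE e.
  exists (sign_vector (flip A (val u))); rewrite ?sign_vector_covector // ffunE uAu.
  by move: ne; case: (_ \in _); case: b.
(* The two ends of an edge in direction [u] agree at [w], so their products have opposite signs. *)
exists (sign_vector A), (sign_vector (flip A (val u))).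
split; [exact: sign_vector_covector | exact: sign_vector_covector |].
have nwu : (val w == val u) = false by rewrite (inj_eq val_inj) eq_sym (negPf nuw).
rewrite !ffunE !in_set eqxx nwu addbT addbF -sgnN mulNr.
suff [->|->] : sgn (val u \in A) * sgn (val w \in A) = 1 \/
               sgn (val u \in A) * sgn (val w \in A) = -1.
- by [].
- by rewrite opprK setUC.
by case: (_ \in A); case: (_ \in A); [left|right|right|left]; apply: val_inj.
Qed.

Lemma strong_elimination X Y e : V != set0 -> steps V -> vc2 V ->
  (forall v, ~~ apex V v) ->
  X \in covectors -> Y \in covectors -> X e * Y e = -1 ->
  exists Z, [/\ Z \in covectors, Z e = 0
    & forall u, X u * Y u != -1 -> Z u = composition X Y u].
Proof.
move=> /set0Pn[T0 VT0] sV v2 cV LX LY XYe.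
(* [x] is [X o Y o T] and [y] is [Y o X o T]; they differ exactly where [X] and [Y] have opposite
   signs. Below, [opp] and [opp'] use [-T] in place of [T]. *)
have both T : T \in V -> exists x y, [/\ x \in V, y \in V,
    forall u, sgn (val u \in x) =
      if X u != 0 then X u else if Y u != 0 then Y u else sgn (val u \in T)
  & forall u, sgn (val u \in y) =
      if Y u != 0 then Y u else if X u != 0 then X u else sgn (val u \in T)].
  move=> VT; have [B VB EB] := covectors_comp LY VT.
  have [C VC EC] := covectors_comp LX VT.
  have [x Vx Ex] := covectors_comp LX VB; have [y Vy Ey] := covectors_comp LY VC.
  by exists x, y; split=> // u; rewrite ?Ex ?Ey ?EB ?EC.
have [x [y [Vx Vy Ex Ey]]] := both T0 VT0.
have opp T : T \in V -> exists2 A, A \in V & forall u,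
    sgn (val u \in A) =
      if X u != 0 then X u else if Y u != 0 then Y u else sgn (val u \notin T).
  move=> VT; have /covectorsP/(_ T VT)[B VB EB] := LY.
  have [A VA EA] := covectors_comp LX VB; exists A => // u; by rewrite EA EB.
have opp' T : T \in V -> exists2 A, A \in V & forall u,
    sgn (val u \in A) =
      if Y u != 0 then Y u else if X u != 0 then X u else sgn (val u \notin T).
  move=> VT; have /covectorsP/(_ T VT)[B VB EB] := LX.
  have [A VA EA] := covectors_comp LY VB; exists A => // u; by rewrite EA EB.
have sepE u : (val u \in sep x y) = (X u * Y u == -1).
  have := Ex u; have := Ey u; rewrite inE.
  have [->|[a ->]] := F3P (X u); have [->|[b ->]] := F3P (Y u);
    rewrite ?eqxx ?sgn_neq0 /= ?mul0r ?mulr0.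
  - by move=> /sgn_inj-> /sgn_inj->; rewrite addbb.
  - by move=> /sgn_inj-> /sgn_inj->; rewrite addbb.
  - by move=> /sgn_inj-> /sgn_inj->; rewrite addbb.
  by move=> /sgn_inj-> /sgn_inj->; case: a b => [] [].
have exy : val e \in sep x y by rewrite sepE XYe.
have Ze0 (D : {set 'I_m}) z : val e \in D -> zero_on D z e = 0.
  by move=> De; rewrite ffunE De.
have compE u : ~~ ((X u == 0) && (Y u == 0)) ->
    sgn (val u \in x) = composition X Y u.
  rewrite Ex ffunE; case: ifP => // /negbFE-> /= ->; by [].
have [/existsP[g /andP[/eqP Xg /eqP Yg]]|/existsPn no0] :=
  boolP [exists g, (X g == 0) && (Y g == 0)]; last first.
  have [C [VC VCe sC _]] := steps_edge sV Vx Vy exy.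
  exists (zero_on [set val e] C); split.
  - exact: edge_covector.
  - by apply: Ze0; rewrite set11.
  move=> u XYu; have uxy : val u \notin sep x y by rewrite sepE.
  have neu : (val u == val e) = false by apply: contraNF uxy => /eqP->.
  rewrite ffunE in_set1 neu -compE // (between_eq sC) //.
  by move: uxy; rewrite inE; do 2!case: (_ \in _).
have neg : val e != val g.
  apply/eqP=> /val_inj E; move: XYe; rewrite E Xg mul0r => /eqP.
  by [].
have [/existsP[a /and3P[nag /eqP Xa /eqP Ya]]|/existsPn no] :=
  boolP [exists a, [&& a != g, X a == 0 & Y a == 0]].
  exfalso.
  have nvag : val g != val a by rewrite (inj_eq val_inj) eq_sym.
  have nea : val a != val e.
    apply/eqP=> /val_inj E; move: XYe; rewrite -E Xa mul0r => /eqP.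
    by [].
  have neg' : val g != val e by rewrite eq_sym.
  (* The four values at [g] and [a] come from [x], its opposite [x'], a vertex [C] between them that
     separates [g] from [a], and the opposite [C'] of [C]. *)
  have two b c : exists T, [/\ T \in V, (val g \in T) = b & (val a \in T) = c].
    have [x' Vx' Ex'] := opp x Vx.
    have x'0 u : X u = 0 -> Y u = 0 -> (val u \in x') = (val u \notin x).
      by move=> X0 Y0; have := Ex' u; rewrite X0 Y0 eqxx => /sgn_inj.
    have mem0 u : X u = 0 -> Y u = 0 -> val u \in sep x x'.
      by move=> X0 Y0; rewrite inE x'0 //; case: (_ \in _).
    have [C [VC _ gaC]] := steps_split sV Vx Vx' nvag (mem0 g Xg Yg) (mem0 a Xa Ya).
    have [C' VC' EC'] := opp C VC.
    have C'0 u : X u = 0 -> Y u = 0 -> (val u \in C') = (val u \notin C).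
      by move=> X0 Y0; have := EC' u; rewrite X0 Y0 eqxx => /sgn_inj.
    move: gaC; rewrite !inE => gaC.
    have [bg|nbg] := eqVneq (val g \in x) b; have [ca|nca] := eqVneq (val a \in x) c.
    - by exists x.
    - have [bC|nbC] := eqVneq (val g \in C) b.
        exists C; split=> //; move: bg nca gaC bC.
        by do !case: (_ \in _) => //; case: b; case: c.
      exists C'; split; rewrite ?C'0 //; move: bg nca gaC nbC;
      by do !case: (_ \in _) => //; case: b; case: c.
    - have [bC|nbC] := eqVneq (val g \in C) b.
        exists C; split=> //; move: nbg ca gaC bC.
        by do !case: (_ \in _) => //; case: b; case: c.
      exists C'; split; rewrite ?C'0 //; move: nbg ca gaC nbC;
      by do !case: (_ \in _) => //; case: b; case: c.
    - exists x'; split; rewrite ?x'0 //; move: nbg nca;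
      by do !case: (_ \in _) => //; case: b; case: c.
  apply: (v2 set0 (val g) (val a) (val e)) => // b c d.
  (* [x1] and [y1] keep the values of [T] at the common zeros [g] and [a] and differ at [e], so one
     of them has the value wanted there. *)
  have [T [VT gT aT]] := two b c; have [x1 [y1 [Vx1 Vy1 Ex1 Ey1]]] := both T VT.
  have E0 (A : {set 'I_m}) i : (i \in sep set0 A) = (i \in A) by rewrite !inE.
  have eXY : [/\ sgn (val e \in x1) = X e, sgn (val e \in y1) = Y e
                 & sgn (val e \in x1) != sgn (val e \in y1)].
    rewrite Ex1 Ey1; move: XYe.
    have [->|[p ->]] := F3P (X e); have [->|[q ->]] := F3P (Y e);
    rewrite ?eqxx ?sgn_neq0 /= ?mul0r ?mulr0 //; do ?[by move/eqP].
    by case: p q => [] [].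
  have [_ _] := eXY; rewrite (inj_eq sgn_inj) => ne.
  have [ed|nd] := eqVneq (val e \in x1) d.
    exists x1 => //; rewrite !E0 ed; split=> //; apply: sgn_inj; rewrite Ex1.
    - by rewrite Xg Yg eqxx gT.
    - by rewrite Xa Ya eqxx aT.
  exists y1 => //; rewrite !E0; split.
  - by apply: sgn_inj; rewrite Ey1 Xg Yg eqxx gT.
  - by apply: sgn_inj; rewrite Ey1 Xa Ya eqxx aT.
  - by move: ne nd; case: (_ \in _); case: (_ \in _); case: d.
have flipE (z A : {set 'I_m}) : z \in V -> A \in V ->
    (forall u, sgn (val u \in A) =
       if u == g then sgn (val g \notin z) else sgn (val u \in z)) ->
    A = flip z (val g).
  move=> Vz VA E; apply/setP=> i; rewrite inE.
  have [->|nig] := eqVneq i (val g).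
    by have := E g; rewrite eqxx => /sgn_inj->; rewrite addbT.
  rewrite addbF; apply/eqP; apply: contraT => neq.
  have iAz : i \in sep A z by rewrite inE; move: neq; do 2!case: (_ \in _).
  have := E (exist _ i (crossedP VA Vz iAz)).
  case: eqP => [E'|_ /sgn_inj /= E']; first by rewrite -E' eqxx in nig.
  by rewrite E' eqxx in neq.
have only u : X u = 0 -> Y u = 0 -> u = g.
  by move=> X0 Y0; have := no u; rewrite X0 Y0 eqxx !andbT negbK => /eqP.
(* Taking the opposite of [x] by [opp] changes it only at common zeros, here at [g] alone. *)
have Vxg : flip x (val g) \in V.
  have [x' Vx' Ex'] := opp x Vx; rewrite -(@flipE x x') // => u.
  rewrite Ex'; have [->|nug] := eqVneq u g; first by rewrite Xg Yg eqxx.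
  rewrite Ex; case: eqP => //= X0; case: eqP => //= Y0.
  by rewrite (only u) ?eqxx in nug.
have Vyg : flip y (val g) \in V.
  have [y' Vy' Ey'] := opp' y Vy; rewrite -(@flipE y y') // => u.
  rewrite Ey'; have [->|nug] := eqVneq u g; first by rewrite Xg Yg eqxx.
  rewrite Ey; case: eqP => //= Y0; case: eqP => //= X0.
  by rewrite (only u) ?eqxx in nug.
have gxy : val g \notin sep x y by rewrite sepE Xg mul0r.
have [z [w [czw ezw szw sxz]]] := consecutive_between Vx Vy Vxg Vyg gxy exy.
have Vz : z \in V by case: czw => -[].
(* This vanishes at [g], where [X o Y] vanishes too, and on [sep z w], where [X] and [Y] are
   opposite and elimination leaves the value free. *)
exists (zero_on (val g |: sep z w) z); split.
- by apply: zero_on_covector => // T VT; apply: antipode.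
- by apply: Ze0; rewrite in_setU1 ezw orbT.
move=> u XYu; have uxy : val u \notin sep x y by rewrite sepE.
have [->|nug] := eqVneq u g; first by rewrite !ffunE setU11 Xg eqxx Yg.
have nuzw : val u \notin sep z w by apply: contra uxy; apply: (subsetP szw).
rewrite ffunE in_setU1 (inj_eq val_inj) (negPf nug) (negPf nuzw) /=.
rewrite -compE; last first.
  by apply/negP=> /andP[/eqP X0 /eqP Y0]; rewrite (only u) ?eqxx in nug.
rewrite (between_eq sxz) //.
by move: uxy; rewrite inE; do 2!case: (_ \in _).
Qed.

Lemma two_dimensional_COM : two_dimensional V -> (forall v, ~~ apex V v) -> is_COM V.
Proof.
move=> /two_dimensionalP[V0 sV v2] cV.
exists U, covectors; split.
- split.
  + have /set0Pn[T VT] := V0; apply/set0Pn; exists (sign_vector T).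
    exact: sign_vector_covector.
  + move=> X Y LX LY; apply/covectorsP=> T VT.
    (* [X o (-Y) o (-T)] equals [X o -(Y o T)]. *)
    have [B VB EB] := covectors_comp LY VT.
    have /covectorsP/(_ B VB)[A VA EA] := LX; exists A => // u.
    rewrite EA !ffunE; have [->|[b ->]] := F3P (X u); rewrite ?eqxx ?sgn_neq0 //=.
    have := EB u; have [->|[c ->]] := F3P (Y u); rewrite ?oppr0 ?eqxx ?sgn_neq0 //=.
      by move=> /sgn_inj->.
    by move=> /sgn_inj->; rewrite sgnN sgn_neq0.
  + by move=> X Y e LX LY XYe; apply: strong_elimination.
- exact: simple_covectors.
by exists sign_vector; apply: sign_vector_iso.
Qed.

End SignVectors.

Theorem proposition37 (m : nat) (V : {set {set 'I_m}}) :
  two_dimensional V ->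
  exists W : {set {set 'I_m}},
    [/\ canonical_completion ('C(m, 0) + 'C(m, 1) + 'C(m, 2)) V W,
        two_dimensional W, is_COM W & isometric (@cube_adj m) V W].
Proof.
move=> tV; have [W [cW tW nW sVW]] := canonical_completion_exists tV.
exists W; split=> //; first exact: two_dimensional_COM.
have /two_dimensionalP[_ sV _] := tV; have /two_dimensionalP[_ sW _] := tW.
exact: steps_isometric.
Qed.
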